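(* Let $\tau$ be the Golomb topology on $\mathbb{N}=\{1,2,3,\dots\}$. Every homeomorphism $h:(\mathbb{N},\tau)\to(\mathbb{N},\tau)$ has the following properties: (1) $h(1)=1$; (2) $h(\Pi)=\Pi$; (3) $\Pi_{h(x)}=h(\Pi_x)$ for every $x\in\mathbb{N}$; (4) there exists a multiplicative bijection $\mu:\mathbb{N}\to\mathbb{N}$ such that $h(x^n)=h(x)^{\mu(n)}$ for all $x,n\in\mathbb{N}$.
   Context: $\mathbb{N}$ is the set of positive integers and $\mathbb{N}_0=\{0\}\cup\mathbb{N}$. The Golomb topology $\tau$ on $\mathbb{N}$ is the topology generated by the base consisting of all arithmetic progressions $a+b\mathbb{N}_0=\{a+bn:n\in\mathbb{N}_0\}$ with $a,b\in\mathbb{N}$ coprime. $\Pi$ is the set of prime numbers, and for $x\in\mathbb{N}$, $\Pi_x$ is the set of prime divisors of $x$ (so $\Pi_1=\emptyset$). A function $\mu:\mathbb{N}\to\mathbb{N}$ is called multiplicative if $\mu(xy)=\mu(x)\cdot\mu(y)$ for all $x,y\in\mathbb{N}$ (not only coprime ones). *)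

(* Defs.v *)
From HB Require Import structures.
From mathcomp Require Import all_boot.
From mathcomp Require Import all_classical topology.

Set Implicit Arguments.
Unset Strict Implicit.
Unset Printing Implicit Defensive.

Local Open Scope classical_set_scope.

Record posnat := Posnat {nat_of_posnat :> nat; _ : 0 < nat_of_posnat}.

HB.instance Definition _ := [isSub for nat_of_posnat].
HB.instance Definition _ := [Countable of posnat by <:].

Lemma posnat_gt0 (x : posnat) : 0 < x.
Proof. exact: valP x. Qed.

(* The multiplicative monoid of positive integers: [1], [x * y] and [x ^+ n]
   in scope [group_scope] are the usual unit, product and power. *)
Definition pos_one : posnat := @Posnat 1 isT.

Lemma pos_mul_subproof (x y : posnat) : 0 < x * y.
Proof. by rewrite muln_gt0 !posnat_gt0. Qed.

Definition pos_mul (x y : posnat) : posnat := Posnat (pos_mul_subproof x y).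

Lemma pos_mulA : associative pos_mul.
Proof. by move=> x y z; apply: val_inj; exact: mulnA. Qed.

Lemma pos_mul1 : left_id pos_one pos_mul.
Proof. by move=> x; apply: val_inj; exact: mul1n. Qed.

Lemma pos_mulr1 : right_id pos_one pos_mul.
Proof. by move=> x; apply: val_inj; exact: muln1. Qed.

HB.instance Definition _ := isSemigroup.Build posnat pos_mulA.
HB.instance Definition _ :=
  Semigroup_isMonoid.Build posnat pos_mul1 pos_mulr1.

Lemma val_posX (x : posnat) (n : nat) : (x ^+ n)%g = x ^ n :> nat.
Proof. by elim: n => // n IHn; rewrite expgS expnS /= IHn. Qed.

Definition arith_prog (a b : posnat) : set posnat :=
  [set x | exists n : nat, x = a + b * n :> nat].

(* The canonical topology of [posnat] is the Golomb topology, not the discrete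
   one carried by [nat]. *)
Definition golomb_index : set (posnat * posnat) :=
  [set ab : posnat * posnat | coprime ab.1 ab.2].

Definition golomb_base (ab : posnat * posnat) : set posnat :=
  arith_prog ab.1 ab.2.

Lemma golomb_cover : \bigcup_(ab in golomb_index) golomb_base ab = setT.
Proof.
apply/seteqP; split=> // x _; exists (x, pos_one); first exact: coprimen1.
by exists 0; rewrite muln0 addn0.
Qed.

Lemma golomb_join (i j : posnat * posnat) (t : posnat) :
  golomb_index i -> golomb_index j -> golomb_base i t -> golomb_base j t ->
  exists k, [/\ golomb_index k, golomb_base k t &
                golomb_base k `<=` golomb_base i `&` golomb_base j].
Proof.
case: i j => [a b] [c d] /=.
rewrite /golomb_index /golomb_base /= => ab cd [m tm] [n tn].
exists (t, pos_mul b d); split.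
- have coprime_prog (u v k : nat) : coprime u v -> coprime (u + v * k) v.
    by move=> uv; rewrite addnC mulnC coprime_sym /coprime gcdnMDl gcdnC.
  by rewrite /= coprimeMr {1}tm tn; apply/andP; split; apply: coprime_prog.
- by exists 0; rewrite muln0 addn0.
- move=> x [k /= xk]; split.
    by exists (m + d * k); rewrite xk tm mulnDr addnA mulnA.
  by exists (n + b * k); rewrite xk tn mulnDr addnA mulnA (mulnC d b).
Qed.

HB.instance Definition _ := isPointed.Build posnat pos_one.
HB.instance Definition _ :=
  isBaseTopological.Build posnat golomb_cover golomb_join.

Lemma golomb_openP (A : set posnat) :
  open A <-> forall x, A x -> exists a b : posnat,
    [/\ coprime a b, arith_prog a b x & arith_prog a b `<=` A].
Proof.
split=> [[D DI <-] x [[a b] Dab abx]|AP].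
  exists a, b; split=> //; first exact: (DI _ Dab).
  by move=> y aby; exists (a, b).
exists [set ab : posnat * posnat | golomb_index ab /\ golomb_base ab `<=` A].
  by move=> ? [].
apply/seteqP; split=> [x [ab [_ +]]|x /AP[a [b [ab abx abA]]]]; first exact.
by exists (a, b).
Qed.

Definition homeomorphism (T U : topologicalType) (h : T -> U) : Prop :=
  exists g : U -> T,
    [/\ cancel h g, cancel g h, continuous h & continuous g].

Definition primes_set : set posnat := [set p : posnat | prime p].

Definition prime_divisors (x : posnat) : set posnat :=
  [set p : posnat | prime p /\ p %| x].

(* Main.v *)
(** Extend a homeomorphism h to 0 by h 0 = 0.  It turns out that h is the
    identity, so mu is the identity too.

    Three distinct points are pairwise coprime iff every nonempty open set has
    a closure containing the intersection of the closures of suitable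
    neighbourhoods of the three points.  Hence h preserves coprimality; so
    h 1 = 1, h p is a power of a prime s(p) for every prime p, and
    p | x iff s(p) | h x.  Moreover h is continuous from the r-adic topology
    on the integers prime to r to the s(r)-adic one.

    For primes q <> r let <q>_r be the closed subgroup generated by q in the
    r-adic units.  Its trace on N is the r-adic closure of the powers of q, so
    it is mapped by h to the trace of <s(q)>_s(r), and likewise for closures
    taken in two primes r, l at once.  The primes r and l are independent for
    q when the closure of the powers of q is <q>_r x <q>_l, that is when the
    supernatural orders of q modulo r^oo and l^oo are coprime.  The order of q
    modulo r^oo is a power of r, i.e. q = 1 mod r, iff any two primes dependent
    on r are dependent on each other; so q = 1 mod r iff s(q) = 1 mod s(r).
    In particular s(2) = 2.

    When q = 1 mod r and r is odd, <q>_r = 1 + r^k Z_r with k = v_r(q - 1), and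
    every k >= 1 occurs.  So h permutes these subgroups respecting inclusion:
    v_s(r)(h x - 1) = v_r(x - 1).  Something slightly weaker holds for r = 2.
    Induction on n then gives h n = n, since h(n+1) - 1 and n have the same
    prime factorisation up to a factor 2. *)

Require Import Defs.
From mathcomp Require Import all_boot cyclic zify.
From mathcomp Require Import all_classical topology.

Set Implicit Arguments.
Unset Strict Implicit.
Unset Printing Implicit Defensive.

(** * Congruences and orders *)

Lemma eqmod_dvd d m x y : d %| m -> x = y %[mod m] -> x = y %[mod d].
Proof. by move=> dm e; rewrite -(modn_dvdm x dm) e modn_dvdm. Qed.

Lemma eqmodM m x x' y y' :
  x = x' %[mod m] -> y = y' %[mod m] -> x * y = x' * y' %[mod m].
Proof. by move=> ex ey; rewrite -modnMm ex ey modnMm. Qed.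

Lemma eqmodX m x y n : x = y %[mod m] -> x ^ n = y ^ n %[mod m].
Proof. by move=> e; rewrite -modnXm e modnXm. Qed.

Lemma eqmod_dvdl p m x y : p %| m -> x = y %[mod m] -> (p %| x) = (p %| y).
Proof. by move=> pm /(eqmod_dvd pm) e; rewrite /dvdn e. Qed.

Lemma eqmod_coprime m x y : x = y %[mod m] -> coprime x m = coprime y m.
Proof. by move=> e; rewrite -coprime_modl e coprime_modl. Qed.

Lemma eqmodMl_cancel m q x y :
  coprime q m -> q * x = q * y %[mod m] -> x = y %[mod m].
Proof.
move=> qm; wlog xy : x y / x <= y => [hw e|].
  by case: (leqP x y) => [|/ltnW] xy; [exact: hw|symmetry; exact: hw].
move=> /esym/eqP; rewrite eqn_mod_dvd ?leq_mul2l ?xy ?orbT //.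
rewrite -mulnBr Gauss_dvdr 1?coprime_sym // -eqn_mod_dvd //.
by move/eqP.
Qed.

Lemma eqmod1 m x : 0 < x -> x = 1 %[mod m] <-> m %| x.-1.
Proof.
move=> x0; rewrite -subn1 -eqn_mod_dvd //; split=> [->//|/eqP//].
Qed.

Lemma chinese_ex m n x y : coprime m n ->
  exists z, z = x %[mod m] /\ z = y %[mod n].
Proof.
by move=> mn; exists (chinese m n x y); rewrite chinese_modl // chinese_modr.
Qed.

Lemma eqmod_mul m n x y : coprime m n ->
  x = y %[mod m] -> x = y %[mod n] -> x = y %[mod m * n].
Proof.
by move=> mn /eqP xm /eqP xn; apply/eqP; rewrite chinese_remainder // xm xn.
Qed.

Lemma mod_order m q : 0 < m -> coprime q m ->
  exists o, 0 < o /\ forall n, q ^ n = 1 %[mod m] <-> o %| n.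
Proof.
move=> m0 qm.
have ex : exists n, (0 < n) && (q ^ n == 1 %[mod m]).
  exists (totient m); rewrite totient_gt0 m0 /=; apply/eqP.
  exact: Euler_exp_totient.
case: (ex_minnP ex) => o /andP[o0 /eqP qo] omin.
exists o; split=> // n; split=> [qn|/dvdnP[k ->]]; last first.
  by rewrite mulnC expnM (eqmodX k qo) exp1n.
have : q ^ (n %% o) = 1 %[mod m].
  move: qn; rewrite {1}(divn_eq n o) expnD mulnC.
  have := eqmodX (n %/ o) qo; rewrite -expnM exp1n mulnC => e1.
  have := eqmodM (erefl (q ^ (n %% o) %% m)) e1; rewrite muln1 => ->; exact.
rewrite /dvdn; case: (posnP (n %% o)) => [->//|nm0 e].
have := omin (n %% o); rewrite nm0 e eqxx => /(_ isT).
by rewrite leqNgt ltn_mod o0.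
Qed.

Lemma eqmod_expIn m q l a b : coprime q m ->
  (forall n, q ^ n = 1 %[mod m] -> l %| n) ->
  q ^ a = q ^ b %[mod m] -> a = b %[mod l].
Proof.
move=> qm ql; wlog ab : a b / a <= b => [hw e|].
  by case: (leqP a b) => [|/ltnW] ab; [exact: hw|symmetry; exact: hw].
rewrite -{1}(subnKC ab) expnD -{1}(muln1 (q ^ a)).
move=> /(eqmodMl_cancel (coprimeXl _ qm))/esym/ql.
by rewrite -eqn_mod_dvd // => /eqP ->.
Qed.

(** Each further [r]-th power multiplies [b - 1] by a sum of [r] terms congruent to 1 modulo [r],
    hence by a multiple of [r]. *)
Lemma expn_r_eq1 r a K : a = 1 %[mod r] -> a ^ (r ^ K) = 1 %[mod r ^ K.+1].
Proof.
move=> ar; elim: K => [|K IH]; first by rewrite expn1.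
case: (posnP a) => [a0|a0].
  have -> : r = 1 by move: ar; rewrite a0; case: r {IH} => [|[|r]].
  by rewrite !exp1n !modn1.
rewrite (expnSr r K) expnM.
have b0 : 0 < a ^ r ^ K by rewrite expn_gt0 a0.
apply/eqmod1; first by rewrite expn_gt0 b0.
rewrite predn_exp expnSr dvdn_mul //; first exact/eqmod1.
have e1 : a ^ r ^ K = 1 %[mod r] by rewrite (eqmodX _ ar) exp1n.
rewrite /dvdn -modn_summ (eq_bigr (fun=> 1 %% r)); last first.
  by move=> i _; rewrite (eqmodX i e1) exp1n.
by rewrite modn_summ sum1_card card_ord modnn.
Qed.

Lemma eqmod_expn m o q a b : q ^ o = 1 %[mod m] -> a = b %[mod o] ->
  q ^ a = q ^ b %[mod m].
Proof.
move=> qo ab; rewrite (divn_eq a o) (divn_eq b o) ab !expnD ![_ * o]mulnC !expnM.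
by apply: eqmodM => //; rewrite (eqmodX _ qo) (eqmodX (b %/ o) qo) !exp1n.
Qed.

(** * Primes with prescribed orders *)

(* The 2-adic units congruent to 3 mod 4 behave differently: raising to the
   square need not add exactly one to the valuation of [b - 1]. *)
Definition wild_mod r := if r == 2 then 4 else r.

Lemma wild_mod_dvd r : r %| wild_mod r.
Proof. by rewrite /wild_mod; case: eqP => [->|]. Qed.

(** For odd [r], writing [b = 1 + r c] linearises the powers modulo [r ^ 2]: the sum becomes
    [r + 'C(r, 2) r c], and [r] divides ['C(r, 2)]. *)
Lemma geom_sum_mod r b : prime r -> b = 1 %[mod wild_mod r] ->
  \sum_(i < r) b ^ i = r %[mod r ^ 2].
Proof.
move=> rp br; rewrite /wild_mod in br; case: eqP br => [->|r2] br.
  rewrite big_ord_recr big_ord1 /= expn0 expn1.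
  by rewrite -modnDmr br.
have r_gt1 := prime_gt1 rp.
have b0 : 0 < b.
  by case: b br => // br; move: br; rewrite mod0n modn_small.
have [c ->] : exists c, b = 1 + r * c.
  have /dvdnP[c cE] := (eqmod1 r b0).1 br.
  by exists c; rewrite mulnC -cE add1n prednK.
have expE i : (1 + r * c) ^ i = 1 + i * (r * c) %[mod r ^ 2].
  elim: i => [//|i IH]; rewrite expnS -modnMmr IH modnMmr.
  have -> : (1 + r * c) * (1 + i * (r * c))
      = 1 + i.+1 * (r * c) + i * c * c * r ^ 2 by lia.
  by rewrite addnC modnMDl.
rewrite -modn_summ (eq_bigr (fun i : 'I_r => (1 + i * (r * c)) %% r ^ 2)); last first.
  by move=> i _; rewrite expE.
rewrite modn_summ big_split /= sum1_card card_ord -big_distrl /=.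
rewrite -(big_mkord xpredT id) /= bin2_sum.
have /dvdnP[k ->] : r %| 'C(r, 2) by apply: prime_dvd_bin => //; lia.
have -> : r + k * r * (r * c) = k * c * r ^ 2 + r by lia.
by rewrite modnMDl.
Qed.

Lemma logn_geom_sum r b : prime r -> b = 1 %[mod wild_mod r] ->
  logn r (\sum_(i < r) b ^ i) = 1.
Proof.
move=> rp br; have e := geom_sum_mod rp br; have r_gt1 := prime_gt1 rp.
have S0 : 0 < \sum_(i < r) b ^ i.
  by case: r rp {br e r_gt1} => // r rp; rewrite big_ord_recl.
apply/eqP; rewrite eqn_leq; apply/andP; split; last first.
  by rewrite -pfactor_dvdn // expn1 (eqmod_dvdl _ e) // dvdn_mull.
rewrite leqNgt -pfactor_dvdn // (eqmod_dvdl _ e) //.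
by rewrite gtnNdvd ?prime_gt0 // -{1}(expn1 r) ltn_exp2l.
Qed.

(** Lifting the exponent: each [r]-th power multiplies [b - 1] by a geometric sum of valuation
    exactly one. *)
Lemma logn_expn_r_pred r a j : prime r -> 1 < a -> a = 1 %[mod wild_mod r] ->
  logn r (a ^ (r ^ j)).-1 = logn r a.-1 + j.
Proof.
move=> rp a1 ar; elim: j => [|j IH]; first by rewrite expn1 addn0.
rewrite expnSr expnM predn_exp; set b := a ^ r ^ j.
have rj0 : 0 < r ^ j by rewrite expn_gt0 prime_gt0.
have b1 : 1 < b by rewrite -(exp1n (r ^ j)) ltn_exp2r.
have br : b = 1 %[mod wild_mod r] by rewrite (eqmodX _ ar) exp1n.
have S1 := logn_geom_sum rp br.
have S0 : 0 < \sum_(i < r) b ^ i by case: posnP S1 => // ->; rewrite logn0.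
by rewrite lognM //; [rewrite IH S1 addn1 addnS | lia].
Qed.

(* [lambda] divides the cyclotomic value Phi_{l^k}(a), so a has order exactly
   [l ^ k] modulo [lambda]. *)
Lemma geom_sum_order l a k lambda : prime l -> prime lambda -> lambda != l ->
  let b := a ^ (l ^ k) in lambda %| \sum_(i < l) b ^ i ->
  [/\ a ^ (l ^ k.+1) = 1 %[mod lambda], b <> 1 %[mod lambda],
      coprime a lambda & lambda = 1 %[mod l ^ k.+1]].
Proof.
move=> lp qp ql b qS; have l1 := prime_gt1 lp; have q1 := prime_gt1 qp.
have blq : b ^ l = 1 %[mod lambda].
  have b0 : 0 < b.
    rewrite lt0n; apply/negP => /eqP b0; move: qS; rewrite b0.
    have -> : l = l.-1.+1 by lia.
    rewrite big_ord_recl /= big1 => [|i _]; last by rewrite exp0n.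
    by rewrite dvdn1; lia.
  apply/eqmod1; first by rewrite expn_gt0 b0.
  by rewrite predn_exp dvdn_mull.
have alq : a ^ (l ^ k.+1) = 1 %[mod lambda] by rewrite expnSr expnM.
have aq : coprime a lambda.
  have := eqmod_coprime alq; rewrite coprime1n coprime_pexpl //.
  by rewrite expn_gt0 prime_gt0.
have b1 : b <> 1 %[mod lambda].
  move=> b1; move: qS.
  rewrite /dvdn -modn_summ (eq_bigr (fun=> 1 %% lambda)); last first.
    by move=> i _; rewrite (eqmodX i b1) exp1n.
  rewrite modn_summ sum1_card card_ord -/(dvdn _ _) dvdn_prime2 //.
  by rewrite (negbTE ql).
split=> //.
have [o [o0 oP]] := mod_order (ltnW q1) aq.
have /(dvdn_pfactor _ _ lp)[m mk oE] := (oP _).1 alq.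
have mE : m = k.+1.
  apply/eqP; rewrite eqn_leq mk ltnNge /=; apply/negP => mk'.
  by apply: b1; apply/oP; rewrite oE dvdn_exp2l.
apply/eqmod1; first exact: ltnW.
rewrite -mE -oE; apply/oP; rewrite -totient_prime //.
exact: Euler_exp_totient.
Qed.

(** The cyclotomic value [S] exceeds [l] and contains the factor [l] at most once, so it has another
    prime factor; modulo that prime the order of [q] is a power of [l]. *)
Lemma ex_prime_order_power q l B : 1 < q -> prime l ->
  exists lambda k, [/\ prime lambda, B < lambda, coprime q lambda,
    q ^ (l ^ k) = 1 %[mod lambda] & q <> 1 %[mod lambda]].
Proof.
move=> q1 lp; have l1 := prime_gt1 lp.
(* The prime found is 1 modulo [l ^ k.+1], hence exceeds [B]. Since [k > 0], [b] is a square when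
   [l = 2], so it is 1 modulo 4 if odd. *)
pose k := B.+1; pose b := q ^ l ^ k; pose S := \sum_(i < l) b ^ i.
have b1 : 1 < b by rewrite -(exp1n (l ^ k)) ltn_exp2r // expn_gt0 prime_gt0.
have Sl : l < S.
  have -> : S = \sum_(i < l.-1) b ^ i + b ^ l.-1.
    by rewrite /S; have -> : l = l.-1.+1 by [lia]; rewrite big_ord_recr.
  have h1 : l.-1 <= \sum_(i < l.-1) b ^ i.
    rewrite -[X in X <= _]card_ord -sum1_card; apply: leq_sum => i _.
    by rewrite expn_gt0 ltnW.
  have h2 : 1 < b ^ l.-1 by rewrite -(exp1n l.-1) ltn_exp2r //; lia.
  lia.
have [x [xp xl xS]] : exists x, [/\ prime x, x != l & x %| S].
  case: (boolP (l %| S)) => lS; last first.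
    exists (pdiv S); split; rewrite ?pdiv_dvd ?pdiv_prime //; try lia.
    by apply: contra lS => /eqP <-; exact: pdiv_dvd.
  have bl : b = 1 %[mod l].
    have S0 : b ^ l = 1 %[mod l].
      apply/eqmod1; first by rewrite expn_gt0 (ltnW b1).
      by rewrite predn_exp dvdn_mull.
    by rewrite -S0 (fermat_little b lp).
  have bl' : b = 1 %[mod wild_mod l].
    move: bl; rewrite /wild_mod; case: eqP => // l2.
    rewrite l2 !modn2 => ob.
    have bE : b = (q ^ 2 ^ B) ^ 2 by rewrite /b l2 /k expnSr expnM.
    have : odd (q ^ 2 ^ B).
      by move: ob; rewrite bE [odd (_ ^ 2)]oddX /=; case: odd.
    rewrite bE.
    move: (q ^ 2 ^ B) => c oc.
    rewrite -(odd_double_half c) oc -modnXm.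
    have : (true + c./2.*2) %% 4 < 4 by rewrite ltn_mod.
    have : odd ((true + c./2.*2) %% 4) by rewrite odd_mod // oddD odd_double.
    by case: (_ %% 4) => [|[|[|[|]]]].
  have := logn_geom_sum lp bl'; rewrite -/S => lS1.
  pose m := S %/ l; have Sm : S = m * l by rewrite /m divnK.
  have m1 : 1 < m.
    rewrite ltnNge; apply/negP => m1.
    by move: Sl; rewrite Sm ltnNge -{2}(mul1n l) leq_mul2r m1 orbT.
  exists (pdiv m); split; rewrite ?pdiv_prime //.
    apply/negP => /eqP pl; have lm : l %| m by rewrite -pl pdiv_dvd.
    have : l ^ 2 %| S by rewrite Sm dvdn_mul.
    by rewrite pfactor_dvdn ?lS1 //; lia.
  by rewrite Sm dvdn_mulr // pdiv_dvd.
have [ak bne co xk] := geom_sum_order lp xp xl xS.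
exists x, k.+1; split=> //; last first.
  by move=> q1x; apply: bne; rewrite (eqmodX _ q1x) exp1n.
have /dvdn_leq : l ^ k.+1 %| x.-1 by apply/eqmod1; rewrite ?prime_gt0.
have := prime_gt1 xp; have := ltn_expl k.+1 l1; rewrite /k; lia.
Qed.

Lemma eqmod1_primes m n : 0 < n ->
  (forall p, prime p -> p %| n -> p = 1 %[mod m]) -> n = 1 %[mod m].
Proof.
elim/ltn_ind: n => n IH n0 pn; case: (ltnP 1 n) => n1; last first.
  by have -> : n = 1 by lia.
have pp := pdiv_prime n1; have pd := pdiv_dvd n.
rewrite -(divnK pd) -(muln1 1); apply: eqmodM; last exact: pn.
apply: IH; first by rewrite ltn_Pdiv // prime_gt1.
  by rewrite divn_gt0 ?prime_gt0 // dvdn_leq.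
by move=> p p_pr pdv; apply: pn => //; rewrite -(divnK pd) dvdn_mulr.
Qed.

(** If every prime factor of [n] were 1 modulo [r ^ k.+1], so would be [n]. *)
Lemma ex_prime_divisor_logn_pred r k n : prime r -> 1 < n ->
  logn r n.-1 = k ->
  (forall p, prime p -> p %| n -> p = 1 %[mod r ^ k]) ->
  exists2 p, prime p & logn r p.-1 = k.
Proof.
move=> rp n1 nk pn.
case: (boolP (all (fun p => r ^ k.+1 %| p.-1) (primes n))) => [/allP al|].
  have : n = 1 %[mod r ^ k.+1].
    apply: eqmod1_primes => [|p pp pdv]; first exact: ltnW.
    apply/eqmod1; first exact: prime_gt0.
    by apply: al; rewrite mem_primes pp pdv ltnW.
  move/(eqmod1 _ (ltnW n1)); rewrite pfactor_dvdn ?nk ?ltnn //; lia.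
case/allPn => p; rewrite mem_primes => /and3P[pp _ pdv] pr.
have p1 := prime_gt1 pp; exists p => //; apply/eqP; rewrite eqn_leq.
rewrite leqNgt -!pfactor_dvdn ?pr //=; try lia.
by apply/eqmod1; [exact: ltnW|exact: pn].
Qed.

Lemma mul_pred_eq b c s : 0 < b -> 0 < c -> 0 < s ->
  (b * c).-1 = b.-1 * s -> b.-1 * s.-1 = b * c.-1.
Proof. by case: b => // b; case: c => // c; case: s => // s _ _ _ /=; nia. Qed.

(** The base [a = r - 1] is -1 modulo [r], which gives [S - 1] the valuation of [b ^ 2 - 1], namely
    [k]. The prime factors of [S] are 1 modulo [r ^ k], so one of them attains this valuation
    exactly. *)
Lemma ex_prime_logn_pred_odd r k : prime r -> odd r -> 0 < k ->
  exists2 q, prime q & logn r q.-1 = k.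
Proof.
move=> rp ro k0; have r1 := prime_gt1 rp.
have r2 : 2 < r by case: r rp ro r1 => [|[|[|]]].
pose a := r.-1; pose b := a ^ r ^ k.-1; pose S := \sum_(i < r) b ^ i.
have k1 : k = k.-1.+1 by lia.
have ba : b = a %[mod r].
  rewrite /b; elim: k.-1 => [|j IH]; first by rewrite expn1.
  by rewrite expnSr expnM (fermat_little _ rp).
have b1 : 1 < b.
  have a1 : 1 < a by rewrite /a; lia.
  by rewrite -(exp1n (r ^ k.-1)) ltn_exp2r // expn_gt0 prime_gt0.
have rb : ~~ (r %| b) by rewrite /dvdn ba modn_small /a; lia.
have rb1 : ~~ (r %| b.-1).
  apply/negP => /(eqmod1 r (ltnW b1)); rewrite ba !modn_small /a; lia.
have [m rm] : exists m, r = m.*2.+1 by exists r./2; rewrite -{1}[r]odd_double_half ro.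
pose T := \sum_(i < m) (b ^ 2) ^ i.
have a2 : a ^ 2 = r * r.-2 + 1.
  by rewrite /a; case: (r) r2 => [|[|s]] //= _; clear; lia.
have a2r : a ^ 2 = 1 %[mod r] by rewrite a2 mulnC modnMDl.
have b2 : b ^ 2 = (a ^ 2) ^ r ^ k.-1 by rewrite -!expnM mulnC.
have b2r : b ^ 2 = 1 %[mod r] by rewrite b2 (eqmodX _ a2r) exp1n.
have Tm : T = m %[mod r].
  rewrite /T -modn_summ (eq_bigr (fun=> 1 %% r)); last first.
    by move=> i _; rewrite (eqmodX i b2r) exp1n.
  by rewrite modn_summ sum1_card card_ord.
have rT : ~~ (r %| T).
  by rewrite /dvdn Tm; clear -rm r1; rewrite modn_small; lia.
have T0 : 0 < T by rewrite lt0n; apply: contraNneq rT => ->; rewrite dvdn0.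
(* With [r = 2 m + 1], [S - 1] is [b (b ^ (2 m) - 1) / (b - 1)]; none of [b], [b - 1] and [T] is
   divisible by [r]. *)
have Sb : b.-1 * S.-1 = b * ((b ^ 2).-1 * T).
  rewrite -predn_exp -expnM mul2n; apply: mul_pred_eq.
  - exact: ltnW.
  - by rewrite expn_gt0 (ltnW b1).
  - by rewrite /S rm big_ord_recl.
  - by rewrite -expnS -rm predn_exp.
have b2_gt1 : 1 < b ^ 2 by rewrite -(exp1n 2) ltn_exp2r.
have b20 : 0 < (b ^ 2).-1 by rewrite -ltnS prednK // (ltnW b2_gt1).
have b0 : 0 < b by exact: ltnW.
have S1 : 1 < S.
  rewrite -subn_gt0 subn1 lt0n; apply: contra_eq_neq Sb => ->.
  by rewrite muln0 neq_ltn !muln_gt0 b0 b20 T0.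
have nr x : ~~ (r %| x) -> logn r x = 0.
  by move=> rx; apply/eqP; rewrite -leqn0 leqNgt logn_gt0 mem_primes rp (negbTE rx) andbF.
have Sk : logn r S.-1 = k.
  have := congr1 (logn r) Sb.
  have b1_0 : 0 < b.-1 by rewrite -ltnS prednK.
  have S1_0 : 0 < S.-1 by rewrite -ltnS prednK // (ltnW S1).
  rewrite !lognM ?muln_gt0 ?b20 ?T0 // (nr _ rb1) (nr _ rb) (nr _ rT) addn0 !add0n b2 => ->.
  rewrite logn_expn_r_pred //.
  - have -> : (a ^ 2).-1 = r * r.-2 by rewrite a2 addn1.
    have r20 : 0 < r.-2 by clear -r2; lia.
    have nr2 : logn r r.-2 = 0 by apply: nr; rewrite gtnNdvd //; clear -r2; lia.
    have rr : logn r r = 1 by rewrite logn_prime // eqxx.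
    by rewrite lognM ?(prime_gt0 rp) // rr nr2 addn0 add1n prednK.
  - by rewrite a2 addn1 ltnS muln_gt0 (prime_gt0 rp) /=; clear -r2; lia.
  - by rewrite /wild_mod; case: eqP => // e; move: r2; rewrite e.
apply: (ex_prime_divisor_logn_pred rp S1 Sk) => p pp pS.
suff pr : p != r by rewrite k1; case: (geom_sum_order rp pp pr pS).
apply/negP => /eqP pr; have : r %| S.-1.
  by rewrite -(expn1 r) pfactor_dvdn ?Sk // -subn1 subn_gt0.
have rS : r %| S by rewrite -pr.
have SE : S = S.-1 + 1 by rewrite addn1 prednK // ltnW.
by move=> rS1; move: rS; rewrite SE dvdn_addr // dvdn1 => /eqP re; move: r2; rewrite re.
Qed.

(** Here [b - 1] has valuation [k.+1], so [n = (b - 1) / 2] has valuation [k]. The prime factors of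
    [n.+1 = (b + 1) / 2] divide the cyclotomic value [b + 1] and are odd, hence are 1 modulo
    [2 ^ k]. *)
Lemma ex_prime_logn_pred_two k : 1 < k ->
  exists2 q, prime q & logn 2 q.-1 = k.
Proof.
move=> k1; pose b := 3 ^ 2 ^ k.-1.
have bE : b = (3 ^ 2) ^ 2 ^ k.-2.
  by rewrite /b -expnM -expnS; congr (_ ^ (_ ^ _)); lia.
have b1 : 1 < b by rewrite -(exp1n (2 ^ k.-1)) ltn_exp2r // expn_gt0.
have bk : logn 2 b.-1 = k.+1.
  by rewrite bE logn_expn_r_pred //= (_ : 8 = 2 ^ 3) // pfactorK //; lia.
have bS : \sum_(i < 2) b ^ i = b.+1 by rewrite big_ord_recr big_ord1.
have : 2 %| b.-1 by rewrite -(expn1 2) pfactor_dvdn // ?bk; lia.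
case/dvdnP => n bn; have n0 : 0 < n by lia.
have nk : logn 2 n = k.
  by move: bk; rewrite bn lognM // (_ : logn 2 2 = 1) // addn1 => - [].
have b1E : b.+1 = n.+1 * 2 by lia.
apply: (@ex_prime_divisor_logn_pred 2 k n.+1) => // p pp pn.
have pS : p %| \sum_(i < 2) b ^ i by rewrite bS b1E dvdn_mulr.
have k1E : k = k.-1.+1 by rewrite prednK // ltnW.
have two_prime : prime 2 by [].
suff pr : p != 2 by rewrite k1E; case: (geom_sum_order two_prime pp pr pS).
apply/negP => /eqP p2; move: pn; rewrite p2.
have : 2 %| n by rewrite -(expn1 2) pfactor_dvdn // nk; lia.
by rewrite !dvdn2 /=; case: odd.
Qed.

(** * Closed subgroups of the r-adic units *)

Lemma eqmod_solve m w t : 0 < m -> coprime w m ->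
  exists j, w * j = t %[mod m].
Proof.
move=> m0 wm; exists (w ^ (totient m).-1 * t).
rewrite mulnA -expnS prednK ?totient_gt0 //.
by rewrite -modnMml Euler_exp_totient // modnMml mul1n.
Qed.

Lemma eqmod_lift m d x y : 0 < m -> d %| m -> y = x %[mod d] ->
  exists t, y + t * d = x %[mod m].
Proof.
move=> m0 dm yx.
have yle : y <= x + y * m by rewrite -{1}(muln1 y) (leq_trans _ (leq_addl _ _)) // leq_mul2l m0 orbT.
have /dvdnP[t tE] : d %| x + y * m - y.
  rewrite -eqn_mod_dvd //; case/dvdnP: dm => e ->.
  by rewrite mulnA addnC modnMDl yx.
by exists t; rewrite -tE subnKC // addnC modnMDl.
Qed.

Lemma expn_1D m u j : (1 + u * m) ^ j = 1 + j * u * m %[mod m ^ 2].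
Proof.
elim: j => [//|j IH]; rewrite expnS -modnMmr IH modnMmr.
have -> : (1 + u * m) * (1 + j * u * m)
    = u * j * u * m ^ 2 + (1 + j.+1 * u * m) by lia.
by rewrite modnMDl.
Qed.

(* Successive approximation: raising [a] to the power [r] increases the
   valuation of [a - 1] by exactly one. *)
Lemma powers_dense r a x : prime r -> 1 < a -> a = 1 %[mod wild_mod r] ->
  x = 1 %[mod r ^ logn r a.-1] -> forall k, exists n, a ^ n = x %[mod r ^ k].
Proof.
move=> rp a1 ar; set K := logn r a.-1 => xK.
have r0 := prime_gt0 rp.
have ar' : a = 1 %[mod r] := eqmod_dvd (wild_mod_dvd r) ar.
have acop : coprime a r by rewrite (eqmod_coprime ar') coprime1n.
have a10 : 0 < a.-1 by rewrite -ltnS prednK // ltnW.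
have K0 : 0 < K.
  by rewrite logn_gt0 mem_primes rp a10 /=; apply/eqmod1; first exact: ltnW.
elim=> [|k [n nE]]; first by exists 0; rewrite !modn1.
case: (ltnP k K) => kK.
  exists 0; rewrite expn0; symmetry; apply: (eqmod_dvd _ xK).
  by rewrite dvdn_exp2l.
have k0 : 0 < k by exact: leq_trans kK.
pose c := a ^ r ^ (k - K).
have ck : logn r c.-1 = k by rewrite logn_expn_r_pred // subnKC.
have c0 : 0 < c by rewrite expn_gt0 ltnW.
have c10 : 0 < c.-1 by case: posnP => // e; move: k0; rewrite -ck e logn0.
have [u ru uE] := pfactor_coprime rp c10; rewrite ck in uE.
have rk0 : 0 < r ^ k.+1 by rewrite expn_gt0 r0.
have [t tE] := eqmod_lift rk0 (dvdn_exp2l r (leqnSn k)) nE.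
(* As [c - 1 = u r ^ k], multiplying by [c ^ j] adds [a ^ n u j r ^ k] modulo [r ^ k.+1]; [j] is
   chosen to correct the next digit. *)
have [j jE] : exists j, (a ^ n * u) * j = t %[mod r].
  by apply: eqmod_solve => //; rewrite coprimeMl coprimeXl // coprime_sym.
exists (n + r ^ (k - K) * j); rewrite expnD expnM -/c -tE.
have -> : c = 1 + u * r ^ k by rewrite -uE add1n prednK.
have dk : r ^ k.+1 %| (r ^ k) ^ 2 by rewrite -expnM dvdn_exp2l; lia.
rewrite -modnMmr (eqmod_dvd dk (expn_1D _ u j)) modnMmr.
rewrite mulnDr muln1 -modnDmr -[RHS]modnDmr; congr ((_ + _) %% _).
rewrite expnS !mulnA -!muln_modl; congr (_ * _).
by rewrite -jE; congr (_ %% _); lia.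
Qed.

Lemma ex_exp_eqmod1_wild r q : prime r -> 1 < q -> coprime q r ->
  exists e, 1 < q ^ e /\ q ^ e = 1 %[mod wild_mod r].
Proof.
move=> rp q1 qr.
have w0 : 0 < wild_mod r by rewrite /wild_mod; case: eqP => // _; exact: prime_gt0.
have qw : coprime q (wild_mod r).
  by move: qr; rewrite /wild_mod; case: eqP => // ->; rewrite (_ : 4 = 2 ^ 2) // => ?; exact: coprimeXr.
exists (totient (wild_mod r)); rewrite Euler_exp_totient //; split=> //.
have t0 : 0 < totient (wild_mod r) by rewrite totient_gt0.
by rewrite -(exp1n (totient (wild_mod r))) ltn_exp2r.
Qed.

(** Some power [q ^ e] is 1 modulo [wild_mod r], and its powers are already dense in a neighbourhood
    of 1: the closed subgroup generated by [q] is open. *)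
Lemma powers_open r q : prime r -> 1 < q -> coprime q r ->
  exists K, forall x, x = 1 %[mod r ^ K] ->
  forall k, exists n, q ^ n = x %[mod r ^ k].
Proof.
move=> rp q1 qr; have [e [qe1 qer]] := ex_exp_eqmod1_wild rp q1 qr.
exists (logn r (q ^ e).-1) => x xK k.
have [n nE] := powers_dense rp qe1 qer xK k.
by exists (e * n); rewrite expnM.
Qed.

Lemma powers_open_mul r q : prime r -> 1 < q -> coprime q r ->
  exists K, forall x, x = q %[mod r ^ K] ->
  forall k, exists n, q ^ n = x %[mod r ^ k].
Proof.
move=> rp q1 qr; have [K KP] := powers_open rp q1 qr.
exists K => x xK k; have r0 := prime_gt0 rp.
have qrk m : coprime q (r ^ m) by exact: coprimeXr.
have rm0 m : 0 < r ^ m by rewrite expn_gt0 r0.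
have [y yE] := eqmod_solve x (rm0 (maxn k K)) (qrk (maxn k K)).
have [|n nE] := KP y _ k.
  apply: (eqmodMl_cancel (qrk K)); rewrite muln1 -xK.
  by apply: (eqmod_dvd _ yE); rewrite dvdn_exp2l ?leq_maxr.
exists n.+1; rewrite expnS (eqmodM (erefl _) nE).
by apply: (eqmod_dvd _ yE); rewrite dvdn_exp2l ?leq_maxl.
Qed.

(* For [q] prime to [r]: [x] lies in the closed subgroup generated by [q] in
   the group of r-adic units. *)
Definition in_powers r q x := forall k, exists n, q ^ n = x %[mod r ^ k].

Definition in_powers2 r l q x :=
  forall k, exists n, q ^ n = x %[mod r ^ k] /\ q ^ n = x %[mod l ^ k].

Definition dependent q r l :=
  ~ (forall x, in_powers r q x -> in_powers l q x -> in_powers2 r l q x).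

(* [order_prime q r l] says that [l] divides the supernatural order of [q] in
   the group of r-adic units, i.e. l = r or l divides the order of q mod r. *)
Definition order_prime q r l := exists K, forall n, q ^ n = 1 %[mod r ^ K] -> l %| n.

(** * Supernatural orders and dependence of primes *)

Lemma order_prime_self q r : prime r -> 1 < q -> coprime q r -> order_prime q r r.
Proof.
move=> rp q1 qr; have r0 := prime_gt0 rp; have r1 := prime_gt1 rp.
(* If [r] did not divide the order of [q] modulo [r ^ K.+1], that order would divide [r - 1], so
   [r ^ K.+1] would divide [q ^ r.-1 - 1]. This [K] makes the modulus too large for that. *)
pose K := q ^ r.-1; exists K.+1.
have rK0 : 0 < r ^ K.+1 by rewrite expn_gt0 r0.
have [o [o0 oP]] := mod_order rK0 (coprimeXr K.+1 qr).
move=> n /oP; apply: dvdn_trans.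
have : o %| r.-1 * r ^ K.
  by apply/oP; rewrite -(totient_pfactor rp (ltn0Sn K)); apply: Euler_exp_totient; exact: coprimeXr.
case: (boolP (r %| o)) => // ro.
rewrite Gauss_dvdl; last by rewrite coprimeXr // coprime_sym prime_coprime.
move/oP/eqmod1; rewrite expn_gt0 (ltnW q1) => /(_ isT)/dvdn_leq.
have q_gt1 : 1 < q ^ r.-1 by rewrite -(exp1n r.-1) ltn_exp2r //; lia.
have := ltn_expl K.+1 r1; rewrite /K in rK0 *; move: (q ^ r.-1) q_gt1 => Q.
move: (r ^ _) => R; lia.
Qed.

(** By [expn_r_eq1], the order of [q] modulo any power of [r] divides [l ^ j] times a power of
    [r]. *)
Lemma order_prime_pow q r l p j : prime r -> prime l -> prime p ->
  q ^ (l ^ j) = 1 %[mod r] -> order_prime q r p -> p = l \/ p = r.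
Proof.
move=> rp lp pp /(fun h => expn_r_eq1 _ h) e [K KP].
have : p %| l ^ j * r ^ K.
  by apply: KP; rewrite expnM; apply: (eqmod_dvd _ (e K)); rewrite dvdn_exp2l.
rewrite Euclid_dvdM // !Euclid_dvdX // => /orP[] /andP[h _]; [left|right].
  by apply/eqP; rewrite -dvdn_prime2.
by apply/eqP; rewrite -dvdn_prime2.
Qed.

Lemma ex_order_prime_neq q r : prime r -> coprime q r -> q <> 1 %[mod r] ->
  exists l, [/\ prime l, l != r & order_prime q r l].
Proof.
move=> rp qr q1; have r1 := prime_gt1 rp.
have [o [o0 oP]] := mod_order (prime_gt0 rp) qr.
have o1 : 1 < o.
  rewrite ltn_neqAle o0 andbT eq_sym; apply/negP => /eqP oE.
  by apply: q1; rewrite -[q]expn1; apply/oP; rewrite oE.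
exists (pdiv o); split; first exact: pdiv_prime.
  have : pdiv o %| r.-1.
    apply: dvdn_trans (pdiv_dvd o) _; apply/oP; rewrite -totient_prime //.
    exact: Euler_exp_totient.
  apply: contraTneq => ->; rewrite gtnNdvd //; lia.
by exists 1 => n; rewrite expn1 => /oP; apply: dvdn_trans; exact: pdiv_dvd.
Qed.

Lemma order_prime_of_pow q r l k : prime r -> prime l -> coprime q r ->
  q ^ (l ^ k) = 1 %[mod r] -> q <> 1 %[mod r] -> order_prime q r l.
Proof.
move=> rp lp qr qk q1; have [o [o0 oP]] := mod_order (prime_gt0 rp) qr.
exists 1 => n; rewrite expn1 => /oP; apply: dvdn_trans.
move: (qk) => /oP/(dvdn_pfactor _ _ lp)[[|m] _ oE]; last by rewrite oE expnS dvdn_mulr.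
by case: q1; rewrite -[q]expn1; apply/oP; rewrite oE.
Qed.

(** When the orders of [q] modulo [r ^ k] and [l ^ k] are coprime, the two exponents are merged by
    the Chinese remainder theorem; a common prime factor [p] obstructs this. *)
Lemma dependentP q r l : prime r -> prime l -> r != l -> 1 < q ->
    coprime q r -> coprime q l ->
  dependent q r l <->
  exists p, [/\ prime p, order_prime q r p & order_prime q l p].
Proof.
move=> rp lp rl q1 qr ql.
have cop_pow a b : coprime (r ^ a) (l ^ b).
  by apply/coprimeXl/coprimeXr; rewrite prime_coprime // dvdn_prime2.
have pow_gt0 p a : prime p -> 0 < p ^ a by move=> pp; rewrite expn_gt0 prime_gt0.
split=> [dep|[p [pp [K1 K1P] [K2 K2P]]] H].
- apply: contrapT => no; apply: dep => x xrP xlP k.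
  have [n1 n1E] := xrP k; have [n2 n2E] := xlP k.
  have [o1 [o10 o1P]] := mod_order (pow_gt0 r k rp) (coprimeXr k qr).
  have [o2 [o20 o2P]] := mod_order (pow_gt0 l k lp) (coprimeXr k ql).
  have o12 : coprime o1 o2.
    rewrite /coprime eqn_leq gcdn_gt0 o10 andbT leqNgt; apply/negP => g1.
    apply: no; exists (pdiv (gcdn o1 o2)); split; first exact: pdiv_prime.
      by exists k => n /o1P; apply: dvdn_trans (dvdn_trans (pdiv_dvd _) (dvdn_gcdl _ _)).
    by exists k => n /o2P; apply: dvdn_trans (dvdn_trans (pdiv_dvd _) (dvdn_gcdr _ _)).
  have [n [nE1 nE2]] := chinese_ex n1 n2 o12.
  exists n; split; [rewrite -n1E; apply: eqmod_expn nE1|rewrite -n2E; apply: eqmod_expn nE2].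
    exact/o1P.
  exact/o2P.
(* The point [x] is close to 1 [r]-adically and to [q] [l]-adically, so a common exponent would be
   both 0 and 1 modulo [p]. *)
- have [K0 K0P] := powers_open rp q1 qr; have [L0 L0P] := powers_open_mul lp q1 ql.
  pose K := maxn K0 K1; pose L := maxn L0 K2.
  have [x [xK xL]] := chinese_ex 1 q (cop_pow K L).
  have sub p' a b y z : a <= b -> y = z %[mod p' ^ b] -> y = z %[mod p' ^ a].
    by move=> ab; apply: eqmod_dvd; rewrite dvdn_exp2l.
  have xr : in_powers r q x by apply/K0P/(sub _ _ K) => //; rewrite leq_maxl.
  have xl : in_powers l q x by apply/L0P/(sub _ _ L) => //; rewrite leq_maxl.
  have [n [nr nl]] := H x xr xl (maxn K L).
  have pn : p %| n.
    apply/K1P/(sub _ _ K); first by rewrite leq_maxr.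
    by rewrite -xK; apply: (sub _ _ _ _ _ _ nr); rewrite leq_maxl.
  have : n = 1 %[mod p].
    apply: (eqmod_expIn (coprimeXr K2 ql) K2P); rewrite expn1.
    apply: (sub _ _ L); first by rewrite leq_maxr.
    by rewrite -xL; apply: (sub _ _ _ _ _ _ nl); rewrite leq_maxr.
  by move=> /(eqmod_dvdl (dvdnn p)); rewrite pn dvdn1 => /esym/eqP p1; move: pp; rewrite p1.
Qed.

(** If [q = 1] modulo [r], the order of [q] at [r] involves only [r], so [r] divides the order at
    every prime dependent on [r]. Otherwise some [l != r] divides it too; primes [x] and [y] where
    the order of [q] involves only [l], [x] and only [r], [y] are then dependent on [r] but not on
    each other. *)
Lemma eqmod1_clique q r : prime q -> prime r -> q != r ->
  q = 1 %[mod r] <->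
  (forall l1 l2, prime l1 -> prime l2 -> l1 != q -> l2 != q -> l1 != r ->
     l2 != r -> l1 != l2 ->
     dependent q r l1 -> dependent q r l2 -> dependent q l1 l2).
Proof.
move=> qp rp qr; have q1 := prime_gt1 qp.
have cop l : prime l -> l != q -> coprime q l.
  by move=> lp lq; rewrite prime_coprime // dvdn_prime2 // eq_sym.
have cqr : coprime q r by apply: cop; rewrite // eq_sym.
split=> [qr1 l1 l2 l1p l2p l1q l2q l1r l2r l12|H].
  have onlyr p : prime p -> order_prime q r p -> p = r.
    by move=> pp /(@order_prime_pow q r r p 0 rp rp pp); rewrite expn1 => /(_ qr1)[].
  move=> /(dependentP rp l1p _ q1 cqr (cop _ l1p l1q)).
  rewrite eq_sym => /(_ l1r)[p [pp /(onlyr _ pp) -> p1]].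
  move=> /(dependentP rp l2p _ q1 cqr (cop _ l2p l2q)).
  rewrite eq_sym => /(_ l2r)[p' [pp' /(onlyr _ pp') -> p2]].
  by apply/(dependentP l1p l2p l12 q1 (cop _ l1p l1q) (cop _ l2p l2q)); exists r.
apply: contrapT => qr1.
have [l [lp lr lo]] := ex_order_prime_neq rp cqr qr1.
(* The lower bounds keep [r], [l], [x] and [y] pairwise distinct. *)
have [x [i [xp xB cx xi x1]]] := ex_prime_order_power (maxn r l) q1 lp.
have [y [j [yp yB cy yj y1]]] := ex_prime_order_power (maxn x l) q1 rp.
have neq z : coprime q z -> prime z -> z != q.
  by rewrite prime_coprime // => + zp; rewrite dvdn_prime2 // eq_sym.
have xr : x != r by rewrite neq_ltn (leq_ltn_trans (leq_maxl r l)) ?orbT.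
have xl : x != l by rewrite neq_ltn (leq_ltn_trans (leq_maxr r l)) ?orbT.
have yx : x < y by rewrite (leq_ltn_trans (leq_maxl x l)).
have yl : y != l by rewrite neq_ltn (leq_ltn_trans (leq_maxr x l)) ?orbT.
have xy : x != y by rewrite neq_ltn yx.
have yr : y != r.
  by rewrite neq_ltn (ltn_trans _ yx) ?orbT // (leq_ltn_trans (leq_maxl r l)).
have d1 : dependent q r x.
  apply/dependentP => //; first by rewrite eq_sym.
  by exists l; split=> //; exact: order_prime_of_pow xi x1.
have d2 : dependent q r y.
  apply/dependentP => //; first by rewrite eq_sym.
  exists r; split=> //; first exact: order_prime_self.
  exact: order_prime_of_pow yj y1.
have := H x y xp yp (neq _ cx xp) (neq _ cy yp) xr yr xy d1 d2.
case/(dependentP xp yp xy q1 cx cy) => p [pp /(order_prime_pow xp lp pp xi) px].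
move=> /(order_prime_pow yp rp pp yj) py.
case: px py => -> [] e; move: lr xr xl yl xy; rewrite ?e ?eqxx // -e ?eqxx //.
Qed.

(** * Closures of progressions and coprimality *)

(** Full residue classes replace progressions with a starting point: for a modulus exceeding [x],
    the class of [x] and the progression from [x] coincide. *)
Definition golomb_continuous (h : nat -> nat) :=
  forall x b, 0 < b -> coprime (h x) b ->
  exists c, [/\ 0 < c, coprime x c & forall y, y = x %[mod c] -> h y = h x %[mod b]].

(* The point 0, whose only neighbourhood is the whole space, is adjoined to
   the Golomb space. *)
Definition golomb_iso h g :=
  [/\ cancel h g, cancel g h, h 0 = 0, golomb_continuous h & golomb_continuous g].

Lemma golomb_iso_sym h g : golomb_iso h g -> golomb_iso g h.
Proof. by case=> hg gh h0 hc gc; split=> //; rewrite -h0 hg. Qed.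

(* The closure of the progression [a + b N] in the Golomb topology. *)
Definition prog_closure a b w := forall d, d %| b -> coprime w d -> w = a %[mod d].

(** This justifies the formula for the closure. The part of [b] supported on the primes of [w] is
    prime to [c], and modulo the complementary part [w] already agrees with [a], so the congruences
    are compatible. *)
Lemma prog_closure_meets a b w c : 0 < b -> 0 < c -> prog_closure a b w ->
  coprime w c -> exists v, v = w %[mod c] /\ v = a %[mod b].
Proof.
move=> b0 c0 wab wc; set pi : nat_pred := \pi(w).
case: (posnP w) wc => [->|w0 wc].
  by rewrite /coprime gcd0n => /eqP ->; exists a; rewrite !modn1.
have wb : coprime w b`_pi^'.
  by rewrite coprime_pi' // /pi part_pnat.
have lc : coprime b`_pi (lcmn b`_pi^' c).
  rewrite coprime_sym /coprime.
  have wl : coprime w (lcmn b`_pi^' c).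
    by rewrite (@coprime_dvdr _ (b`_pi^' * c)) ?coprimeMr ?wb // dvdn_lcm dvdn_mulr // dvdn_mull.
  have l0 : 0 < lcmn b`_pi^' c by rewrite lcmn_gt0 part_gt0.
  rewrite -/(coprime _ _) coprime_sym; apply: (@pnat_coprime pi); first exact: part_pnat.
  by rewrite -coprime_pi'.
have [v [v1 v2]] := chinese_ex a w lc.
exists v; split; first exact: eqmod_dvd (dvdn_lcmr _ _) v2.
rewrite -(partnC pi b0); apply: eqmod_mul => //; first exact: coprime_partC.
rewrite (eqmod_dvd (dvdn_lcml _ _) v2); apply: wab => //; exact: dvdn_part.
Qed.

Lemma prog_closure_map g u c' v c w : golomb_continuous g -> 0 < c' ->
  (forall y, y = u %[mod c'] -> g y = v %[mod c]) ->
  0 < c -> prog_closure u c' w -> prog_closure v c (g w).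
Proof.
move=> gc c'0 guv c0 wu d dc gwd.
have [e [e0 we ge]] := gc w d (dvdn_gt0 c0 dc) gwd.
have [y [yw yu]] := prog_closure_meets c'0 e0 wu we.
by rewrite -(ge y yw); apply: eqmod_dvd dc (guv y yu).
Qed.

Definition closures_dominated x y z := forall a b, 0 < b -> coprime a b ->
  exists c1 c2 c3, [/\ 0 < c1, 0 < c2 & 0 < c3] /\
    [/\ coprime x c1, coprime y c2, coprime z c3 &
        forall w, prog_closure x c1 w -> prog_closure y c2 w -> prog_closure z c3 w ->
        prog_closure a b w].

Lemma closures_dominated_iso h g x y z : golomb_iso h g ->
  closures_dominated x y z -> closures_dominated (h x) (h y) (h z).
Proof.
move=> [hg gh h0 hc gc] T a b b0 ab.
have hga : coprime (h (g a)) b by rewrite gh.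
have [e [e0 ae he]] := hc (g a) b b0 hga.
have [c1 [c2 [c3 [[c10 c20 c30] [x1 y2 z3 dom]]]]] := T (g a) e e0 ae.
have near u c : 0 < c -> coprime u c -> exists c', [/\ 0 < c', coprime (h u) c'
    & forall w, prog_closure (h u) c' w -> prog_closure u c (g w)].
  move=> c0 uc; have := gc (h u) c c0; rewrite hg => /(_ uc)[c' [c'0 uc' gu]].
  by exists c'; split=> // w; apply: prog_closure_map.
have [d1 [d10 xd1 D1]] := near x c1 c10 x1.
have [d2 [d20 yd2 D2]] := near y c2 c20 y2.
have [d3 [d30 zd3 D3]] := near z c3 c30 z3.
exists d1, d2, d3; split=> //; split=> // w /D1 w1 /D2 w2 /D3 w3.
rewrite -(gh w) -[a]gh; apply: (prog_closure_map (u := g a) (c' := e)) => //.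
exact: dom.
Qed.

(** A prime [p] of [b] divides at most one of the three points, so a [w] not divisible by [p] would
    be congruent to two of them modulo [p ^ K]. Hence every prime of [b] divides [w], and the
    closure condition modulo [b] is vacuous. *)
Lemma closures_dominated_coprime x y z : 0 < x -> 0 < y -> 0 < z ->
  x != y -> y != z -> x != z -> coprime x y -> coprime y z -> coprime x z ->
  closures_dominated x y z.
Proof.
move=> x0 y0 z0 xy yz xz cxy cyz cxz a b b0 ab.
(* Each [p ^ K] exceeds the three points, so congruence modulo [p ^ K] forces equality. [U u] is the
   part of [b ^ K] prime to [u]. *)
pose K := x + y + z; pose U u := (b ^ K)`_(\pi(u)^').
have U0 u : 0 < U u by rewrite part_gt0.
have cU u : 0 < u -> coprime u (U u) by move=> u0; rewrite coprime_pi' ?part_pnat.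
exists (U x), (U y), (U z); split=> //; split; try exact: cU.
move=> w wx wy wz.
have UP u p : 0 < u -> prime p -> p %| b -> ~~ (p %| u) -> p ^ K %| U u.
  move=> u0 pp pb pu.
  have pK : p ^ K %| b ^ K by rewrite dvdn_exp2r.
  rewrite -(@part_pnat_id (\pi(u)^') (p ^ K)).
    by apply: partn_dvd; rewrite // expn_gt0 b0.
  by rewrite pnatX pnatE // inE /= mem_primes pp u0 (negbTE pu).
have w_dvd p : prime p -> p %| b -> p %| w.
  move=> pp pb; apply/negPn/negP => pw.
  have wpK : coprime w (p ^ K) by rewrite coprimeXr // coprime_sym prime_coprime.
  have two u v : 0 < u -> 0 < v -> u <= K -> v <= K -> u != v -> coprime u v ->
      prog_closure u (U u) w -> prog_closure v (U v) w -> (p %| u) || (p %| v).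
    move=> u0 v0 uK vK uv cuv wu wv; apply/negPn/negP; rewrite negb_or => /andP[pu pv].
    have : u = v %[mod p ^ K].
      by rewrite -(wu _ (UP u p u0 pp pb pu)) // -(wv _ (UP v p v0 pp pb pv)).
    have pK := ltn_expl K (prime_gt1 pp).
    rewrite !modn_small ?(leq_ltn_trans uK) ?(leq_ltn_trans vK) // => e.
    by rewrite e eqxx in uv.
  have ncop u v : coprime u v -> p %| u -> p %| v -> False.
    move=> cuv pu pv; have : p %| gcdn u v by rewrite dvdn_gcd pu.
    by rewrite (eqP cuv) dvdn1 => /eqP p1; move: pp; rewrite p1.
  have xK : x <= K by rewrite /K -addnA leq_addr.
  have yK : y <= K by rewrite /K addnAC leq_addl.
  have zK : z <= K by rewrite /K leq_addl.
  have := two x y x0 y0 xK yK xy cxy wx wy.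
  have := two y z y0 z0 yK zK yz cyz wy wz.
  have := two x z x0 z0 xK zK xz cxz wx wz.
  case/orP=> h1 /orP[] h2 /orP[] h3;
    by [apply: (ncop _ _ cxy)|apply: (ncop _ _ cyz)|apply: (ncop _ _ cxz)].
move=> d db wd; have d0 := dvdn_gt0 b0 db.
suff -> : d = 1 by rewrite !modn1.
apply/eqP; rewrite eqn_leq d0 andbT leqNgt; apply/negP => d1.
have : pdiv d %| gcdn w d.
  by rewrite dvdn_gcd pdiv_dvd w_dvd ?pdiv_prime // (dvdn_trans (pdiv_dvd d)).
rewrite (eqP wd) dvdn1 => /eqP p1; have := pdiv_prime d1; by rewrite p1.
Qed.

Lemma coprime_prime p x : prime p -> coprime x p = ~~ (p %| x).
Proof. by move=> pp; rewrite coprime_sym prime_coprime. Qed.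

Lemma not_coprimeP x y : 0 < x ->
  reflect (exists p, [/\ prime p, p %| x & p %| y]) (~~ coprime x y).
Proof.
move=> x0; apply: (iffP idP) => [nxy|[p [pp px py]]].
  have g1 : 1 < gcdn x y by rewrite ltn_neqAle eq_sym nxy gcdn_gt0 x0.
  exists (pdiv (gcdn x y)); split; first exact: pdiv_prime.
    exact: dvdn_trans (pdiv_dvd _) (dvdn_gcdl _ _).
  exact: dvdn_trans (pdiv_dvd _) (dvdn_gcdr _ _).
apply/negP => /eqP g1; have : p %| gcdn x y by rewrite dvdn_gcd px.
by rewrite g1 dvdn1 => /eqP p1; move: pp; rewrite p1.
Qed.

(** A divisor of [b] prime to [w] is prime to [q], hence divides [p ^ m]. *)
Lemma prog_closure_local p u b w m q :
  b %| p ^ m * q -> w = u %[mod p ^ m] -> q %| w -> prog_closure u b w.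
Proof.
move=> bd wu qw d db wd; apply: eqmod_dvd wu.
rewrite -(@Gauss_dvdl d _ q) ?(dvdn_trans db) //.
by rewrite coprime_sym; exact: coprime_dvdl wd.
Qed.

(** Neighbourhoods of points divisible by [p] do not constrain residues modulo powers of [p]. So a
    [w] in the three closures needs at most to follow [z] there, and can avoid the closure of the
    class of [t + p] modulo [p ^ 2]. *)
Lemma coprime_dominated x y z : 0 < x -> 0 < y -> closures_dominated x y z ->
  coprime x y.
Proof.
move=> x0 y0 T; apply/negPn/negP => /(not_coprimeP _ x0)[p [pp px py]].
have p0 := prime_gt0 pp; have p1 := prime_gt1 pp.
(* When [p] divides [z] as well, the residue of [w] is free and 1 is taken. *)
pose t := if p %| z then 1 else z.
have pt : ~~ (p %| t) by rewrite /t; case: ifP => [_|->//]; rewrite dvdn1; lia.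
have ctp m : coprime t (p ^ m) by rewrite coprimeXr // coprime_sym prime_coprime.
have p20 : 0 < p ^ 2 by rewrite expn_gt0 p0.
have ctp2 : coprime (t + p) (p ^ 2).
  by apply: coprimeXr; rewrite coprime_sym prime_coprime // dvdn_addl.
have [c1 [c2 [c3 [[c10 c20 c30] [xc1 yc2 zc3 dom]]]]] := T _ _ p20 ctp2.
pose c := c1 * c2 * c3; have c0 : 0 < c by rewrite !muln_gt0 c10 c20.
have [Q pQ cE] := pfactor_coprime pp c0.
(* Taking [w = 0] modulo [Q] makes every divisor of [c] prime to [w] divide [p ^ M]; [M >= 2]
   controls [w] modulo [p ^ 2]. *)
pose M := maxn 2 (logn p c).
have [w [wt wQ]] := chinese_ex t 0 (coprimeXl M pQ).
have pw : ~~ (p %| w).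
  by rewrite (eqmod_dvdl _ wt) // -{1}(expn1 p) dvdn_exp2l // /M leq_max.
have dpow d : d %| c -> coprime w d -> d %| p ^ M.
  move=> dc wd; apply: (@dvdn_trans (p ^ logn p c)); last by rewrite dvdn_exp2l ?leq_maxr.
  rewrite -(@Gauss_dvdl d _ Q) 1?mulnC -?cE // coprime_sym.
  by apply: coprime_dvdl wd; rewrite /dvdn wQ mod0n.
have triv u e v : p %| u -> coprime u e -> e %| c -> prog_closure v e w.
  move=> pu ue ec d de wd; suff -> : d = 1 by rewrite !modn1.
  have : d %| p ^ M by apply: dpow => //; exact: dvdn_trans de ec.
  have : coprime d (p ^ M).
    rewrite coprimeXr //; apply: coprime_dvdr pu _; rewrite coprime_sym.
    exact: coprime_dvdr de ue.
  by rewrite /coprime => /eqP g /gcdn_idPl; rewrite g.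
have := dom w (triv x _ _ px xc1 _) (triv y _ _ py yc2 _) _ (p ^ 2) (dvdnn _) _.
have cwp : coprime w (p ^ 2) by rewrite coprimeXr // coprime_sym prime_coprime.
have c1c : c1 %| c by rewrite /c -mulnA dvdn_mulr.
have c2c : c2 %| c by rewrite /c dvdn_mulr // dvdn_mull.
have c3c : c3 %| c by rewrite /c dvdn_mull.
move=> /(_ c1c c2c).
have h3 : prog_closure z c3 w.
  case: (boolP (p %| z)) => pz; first exact: triv pz zc3 c3c.
  move=> d dc3 wd; have : d %| p ^ M by apply: dpow => //; exact: dvdn_trans dc3 c3c.
  by move=> /eqmod_dvd/(_ wt); rewrite /t (negbTE pz).
move=> /(_ h3 cwp).
have -> : w %% p ^ 2 = t %% p ^ 2.
  by apply: (eqmod_dvd _ wt); rewrite dvdn_exp2l // leq_maxl.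
move/esym/eqP; rewrite eqn_mod_dvd ?leq_addr // addKn gtnNdvd //.
by rewrite -{1}(expn1 p) ltn_exp2l.
Qed.

(** * Homeomorphisms, coprimality and prime divisors *)

Lemma iso_gt0 h g x : golomb_iso h g -> 0 < x -> 0 < h x.
Proof.
move=> [hg gh h0 _ _]; rewrite !lt0n; apply: contraNneq => hx0.
by rewrite -[x]hg hx0 -{1}h0 hg.
Qed.

Lemma iso_inj h g : golomb_iso h g -> injective h.
Proof. by case=> hg _ _ _ _; exact: can_inj hg. Qed.

Lemma iso_coprime h g x y : golomb_iso h g -> 0 < x -> 0 < y -> x != y ->
  coprime x y -> coprime (h x) (h y).
Proof.
(* The third point is coprime to [x] and [y] and larger than both. *)
move=> hi x0 y0 xy cxy; pose z := x * y + 1.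
have cz : coprime x z /\ coprime y z.
  by split; rewrite /coprime /z ?gcdnMDl ?gcdn1 // mulnC gcdnMDl gcdn1.
have xz : x != z by rewrite neq_ltn /z addn1 ltnS leq_pmulr.
have yz : y != z by rewrite neq_ltn /z addn1 ltnS leq_pmull.
have z0 : 0 < z by rewrite /z addn1.
have := closures_dominated_coprime x0 y0 z0 xy yz xz cxy cz.2 cz.1.
move/(closures_dominated_iso hi); apply: coprime_dominated; exact: iso_gt0 hi _.
Qed.

(** Were [h 1 > 1], it would be coprime to its own square, because 1 is coprime to every other
    point. *)
Lemma iso_1 h g : golomb_iso h g -> h 1 = 1.
Proof.
move=> hi; have [hg gh h0 _ _] := hi; have gi := golomb_iso_sym hi.
have u0 : 0 < h 1 := iso_gt0 hi (ltn0Sn 0).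
apply/eqP; rewrite eqn_leq u0 andbT leqNgt; apply/negP => u1.
have uu : 0 < h 1 ^ 2 by rewrite expn_gt0 u0.
have ne : g (h 1 ^ 2) != 1.
  apply/negP => /eqP e; move: (gh (h 1 ^ 2)); rewrite e => /eqP.
  by rewrite -{1}(expn1 (h 1)) eqn_exp2l.
have := iso_coprime hi (ltn0Sn 0) (iso_gt0 gi uu); rewrite eq_sym ne coprime1n gh.
move=> /(_ isT isT); rewrite coprime_pexpr // /coprime gcdnn => /eqP e.
by rewrite e in u1.
Qed.

(* [prime_image h p] is the prime of which [h p] is a power. *)
Definition prime_image (h : nat -> nat) p := pdiv (h p).

Lemma prime_image_prime h g p : golomb_iso h g -> prime p -> prime (prime_image h p).
Proof.
move=> hi pp; apply: pdiv_prime; rewrite ltn_neqAle (iso_gt0 hi) ?prime_gt0 // andbT.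
apply: contraTneq pp => e; suff -> : p = 1 by [].
by apply: (iso_inj hi); rewrite (iso_1 hi).
Qed.

(** If distinct primes [a] and [b] divide [h p], then [p] divides both [g a] and [g b], although [g]
    preserves coprimality. *)
Lemma prime_image_unique h g p a b : golomb_iso h g -> prime p ->
  prime a -> prime b -> a %| h p -> b %| h p -> a = b.
Proof.
move=> hi pp pa pb ap bp; have [hg gh _ _ _] := hi; have gi := golomb_iso_sym hi.
apply/eqP/negPn/negP => ab.
have hp0 := iso_gt0 hi (prime_gt0 pp).
have pdvd c d : prime c -> prime d -> c != d -> c %| h p -> d %| h p -> p %| g c.
  move=> pc pd cd cp dp; apply/negPn/negP => pgc.
  have : coprime (h (g c)) (h p).
    apply: (iso_coprime hi) => //.
    - exact: iso_gt0 gi (prime_gt0 pc).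
    - exact: prime_gt0.
    - apply: contraNneq cd => e; move: dp; rewrite -e gh dvdn_prime2 // eq_sym.
      by move/eqP ->.
    - by rewrite coprime_prime.
  rewrite gh; apply/negP/(not_coprimeP _ (prime_gt0 pc)); by exists c.
have : coprime (g a) (g b).
  by apply: (iso_coprime gi); rewrite ?prime_gt0 // prime_coprime // dvdn_prime2.
apply/negP/(not_coprimeP _ (iso_gt0 gi (prime_gt0 pa))); exists p; split=> //.
  exact: pdvd ab _ _.
by apply: pdvd bp ap => //; rewrite eq_sym.
Qed.

Lemma prime_image_dvd h g p x : golomb_iso h g -> prime p ->
  (prime_image h p %| h x) = (p %| x).
Proof.
move=> hi pp; have [hg gh h0 _ _] := hi; have gi := golomb_iso_sym hi.
case: (posnP x) => [->|x0]; first by rewrite h0 !dvdn0.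
have pi := prime_image_prime hi pp.
have ip : prime_image h p %| h p := pdiv_dvd _.
have [->|px] := eqVneq p x; first by rewrite dvdnn pdiv_dvd.
have p0 := prime_gt0 pp; have hp0 := iso_gt0 hi p0; have hx0 := iso_gt0 hi x0.
apply/idP/idP => d; apply/negPn/negP => nd.
  have : coprime (h p) (h x) by apply: (iso_coprime hi); rewrite // prime_coprime.
  by apply/negP/(not_coprimeP _ hp0); exists (prime_image h p).
suff : coprime p x by rewrite prime_coprime // d.
rewrite -(hg p) -(hg x); apply: (iso_coprime gi) => //.
  by rewrite (inj_eq (iso_inj hi)).
apply/negPn/negP => /(not_coprimeP _ hp0)[a [pa ap ax]].
by rewrite -(prime_image_unique hi pp pa pi ap ip) ax in nd.
Qed.

Lemma prime_imageK h g p : golomb_iso h g -> prime p ->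
  prime_image g (prime_image h p) = p.
Proof.
move=> hi pp; have [hg gh h0 _ _] := hi; have gi := golomb_iso_sym hi.
have pi := prime_image_prime hi pp; have pii := prime_image_prime gi pi.
apply/eqP; rewrite -dvdn_prime2 // -{2}(hg p) (prime_image_dvd _ gi) //.
exact: pdiv_dvd.
Qed.

Lemma prime_image_inj h g p q : golomb_iso h g -> prime p -> prime q ->
  prime_image h p = prime_image h q -> p = q.
Proof. by move=> hi pp pq e; rewrite -(prime_imageK hi pp) e (prime_imageK hi). Qed.

Lemma prime_image_pow h g p n : golomb_iso h g -> prime p ->
  exists m, h (p ^ n) = prime_image h p ^ m.
Proof.
move=> hi pp; have gi := golomb_iso_sym hi; have [hg gh _ _ _] := hi.
have pi := prime_image_prime hi pp.
have h0 : 0 < h (p ^ n) by rewrite (iso_gt0 hi) // expn_gt0 prime_gt0.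
exists (logn (prime_image h p) (h (p ^ n))); rewrite -p_part part_pnat_id //.
apply/pnatP => // q pq qd; rewrite inE /=; apply/eqP.
have := prime_image_dvd (h (p ^ n)) gi pq; rewrite qd hg Euclid_dvdX; last exact: prime_image_prime gi pq.
case/andP; rewrite dvdn_prime2 //; last exact: prime_image_prime gi pq.
by move=> /eqP <- _; rewrite (prime_imageK gi).
Qed.

(** Golomb neighbourhoods also involve primes other than [r]. A point [z] that is [r]-adically close
    to [y] and divisible by the rest of the moduli lies in the closures of neighbourhoods of both
    [x] and [y], so [h z] agrees with [h x] and [h y]. *)
Lemma iso_padic_continuous h g r x k : golomb_iso h g -> prime r -> ~~ (r %| x) ->
  exists m, forall y, y = x %[mod r ^ m] -> h y = h x %[mod prime_image h r ^ k].
Proof.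
move=> hi rp rx; have [hg gh h0 hc _] := hi.
pose s := prime_image h r; have sp : prime s := prime_image_prime hi rp.
have sk0 : 0 < s ^ k by rewrite expn_gt0 prime_gt0.
have cop u : ~~ (r %| u) -> coprime (h u) (s ^ k).
  by move=> ru; rewrite coprimeXr // coprime_prime // (prime_image_dvd _ hi).
have near u : ~~ (r %| u) -> exists b, 0 < b /\ forall z, ~~ (r %| z) ->
    prog_closure u b z -> h z = h u %[mod s ^ k].
  move=> ru; have [b [b0 ub hb]] := hc u _ sk0 (cop u ru).
  exists b; split=> // z rz zu.
  exact: (prog_closure_map hc b0 hb sk0 zu) (dvdnn _) (cop z rz).
have [b [b0 hb]] := near x rx.
pose m := (logn r b).+1; exists m => y yx.
have ry : ~~ (r %| y) by rewrite (eqmod_dvdl _ yx) // dvdn_exp.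
have [c [c0 hcy]] := near y ry.
have bc0 : 0 < b * c by rewrite muln_gt0 b0.
pose q := (b * c)`_r^'; pose M := maxn m (logn r c).
have cq n : coprime (r ^ n) q.
  by rewrite coprimeXl // prime_coprime // -p'natE // part_pnat.
have [z [zy zq]] := chinese_ex y 0 (cq M).
have qz : q %| z by rewrite /dvdn zq mod0n.
have rz : ~~ (r %| z) by rewrite (eqmod_dvdl _ zy) // dvdn_exp // /M leq_max.
have dq u n : 0 < u -> u %| b * c -> logn r u <= n -> u %| r ^ n * q.
  move=> u0 ud un; rewrite -(partnC r u0) dvdn_mul ?partn_dvd //.
  by rewrite p_part dvdn_exp2l.
have <- : h z = h y %[mod s ^ k].
  apply: hcy rz _; apply: (@prog_closure_local r _ _ _ M q) => //.
  by apply: dq; rewrite ?dvdn_mull ?leq_maxr.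
apply: hb rz _; apply: (@prog_closure_local r _ _ _ m q) => //.
  by apply: dq; rewrite ?dvdn_mulr.
by rewrite -yx; apply: eqmod_dvd zy; rewrite dvdn_exp2l // leq_maxl.
Qed.

(** * Valuations of h n - 1 *)

Lemma in_powers_ndvd r q x : prime r -> prime q -> r != q ->
  in_powers r q x -> ~~ (r %| x).
Proof.
move=> rp qp rq /(_ 1)[n]; rewrite expn1 => e.
by rewrite -(eqmod_dvdl (dvdnn r) e) Euclid_dvdX // dvdn_prime2 // (negbTE rq).
Qed.

Lemma iso_in_powers2 h g r l q x : golomb_iso h g ->
  prime r -> prime l -> prime q -> r != q -> l != q ->
  in_powers2 r l q x ->
  in_powers2 (prime_image h r) (prime_image h l) (prime_image h q) (h x).
Proof.
move=> hi rp lp qp rq lq H k.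
have xr : ~~ (r %| x) by apply: (in_powers_ndvd rp qp rq) => j; have [n []] := H j; exists n.
have xl : ~~ (l %| x) by apply: (in_powers_ndvd lp qp lq) => j; have [n []] := H j; exists n.
have [m1 m1P] := iso_padic_continuous k hi rp xr.
have [m2 m2P] := iso_padic_continuous k hi lp xl.
have [n [nr nl]] := H (maxn m1 m2).
have [i iE] := prime_image_pow n hi qp.
exists i; rewrite -iE; split.
  by apply/m1P; apply: eqmod_dvd nr; rewrite dvdn_exp2l // leq_maxl.
by apply/m2P; apply: eqmod_dvd nl; rewrite dvdn_exp2l // leq_maxr.
Qed.

Lemma in_powers2_diag r q x : in_powers r q x <-> in_powers2 r r q x.
Proof. by split=> H k; have := H k => -[n]; [|case]; exists n. Qed.

Lemma iso_in_powers_imp h g r q x : golomb_iso h g -> prime r -> prime q -> r != q ->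
  in_powers r q x -> in_powers (prime_image h r) (prime_image h q) (h x).
Proof.
move=> hi rp qp rq /in_powers2_diag H; apply/in_powers2_diag.
exact: (iso_in_powers2 hi).
Qed.

Lemma prime_image_neq h g p q : golomb_iso h g -> prime p -> prime q ->
  p != q -> prime_image h p != prime_image h q.
Proof. by move=> hi pp qp; apply: contra_neq; exact: prime_image_inj hi pp qp. Qed.

Lemma iso_in_powers h g r q x : golomb_iso h g -> prime r -> prime q -> r != q ->
  in_powers (prime_image h r) (prime_image h q) (h x) <-> in_powers r q x.
Proof.
move=> hi rp qp rq; split; last exact: iso_in_powers_imp hi rp qp rq.
have [hg _ _ _ _] := hi.
move/(iso_in_powers_imp (golomb_iso_sym hi) (prime_image_prime hi rp)
        (prime_image_prime hi qp) (prime_image_neq hi rp qp rq)).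
by rewrite hg !(prime_imageK hi).
Qed.

Lemma iso_dependent h g q r l : golomb_iso h g ->
  prime q -> prime r -> prime l -> r != q -> l != q ->
  dependent q r l -> dependent (prime_image h q) (prime_image h r) (prime_image h l).
Proof.
move=> hi qp rp lp rq lq dep H; apply: dep => x xr xl.
have [hg _ _ _ _] := hi.
have := H _ ((iso_in_powers x hi rp qp rq).2 xr) ((iso_in_powers x hi lp qp lq).2 xl).
move/(iso_in_powers2 (golomb_iso_sym hi) (prime_image_prime hi rp)
        (prime_image_prime hi lp) (prime_image_prime hi qp)
        (prime_image_neq hi rp qp rq) (prime_image_neq hi lp qp lq)).
by rewrite hg !(prime_imageK hi).
Qed.

Lemma iso_eqmod1_prime h g q r : golomb_iso h g -> prime q -> prime r -> q != r ->
  q = 1 %[mod r] -> prime_image h q = 1 %[mod prime_image h r].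
Proof.
move=> hi qp rp qr; have gi := golomb_iso_sym hi.
move/(eqmod1_clique qp rp qr) => H.
apply/(eqmod1_clique (prime_image_prime hi qp) (prime_image_prime hi rp)).
  exact: prime_image_neq hi qp rp qr.
move=> l1 l2 l1p l2p l1q l2q l1r l2r l12 d1 d2.
rewrite -(prime_imageK gi l1p) -(prime_imageK gi l2p).
have pull l p : prime l -> prime p -> l != prime_image h p -> prime_image g l != p.
  by move=> lp pp; apply: contra_neq => <-; rewrite (prime_imageK gi).
have back r' l : prime r' -> prime l -> r' != prime_image h q -> l != prime_image h q ->
    dependent (prime_image h q) r' l -> dependent q (prime_image g r') (prime_image g l).
  move=> r'p lp r'q lq /(iso_dependent gi (prime_image_prime hi qp) r'p lp r'q lq).
  by rewrite (prime_imageK hi).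
apply: (iso_dependent hi) => //; try exact: (prime_image_prime gi).
- exact: pull.
- exact: pull.
apply: H; try exact: (prime_image_prime gi); try exact: pull.
- exact: prime_image_neq gi l1p l2p l12.
- rewrite -{1}(prime_imageK hi rp); apply: back => //; first exact: prime_image_prime hi rp.
  by rewrite eq_sym; exact: prime_image_neq hi qp rp qr.
- rewrite -{1}(prime_imageK hi rp); apply: back => //; first exact: prime_image_prime hi rp.
  by rewrite eq_sym; exact: prime_image_neq hi qp rp qr.
Qed.

(** Every odd prime is 1 modulo 2: if [prime_image g 2] were odd, its image 2 would be 1 modulo the
    prime [prime_image h 2]. *)
Lemma prime_image_2 h g : golomb_iso h g -> prime_image h 2 = 2.
Proof.
move=> hi; have gi := golomb_iso_sym hi; have p2 : prime 2 by [].
have sp := prime_image_prime hi p2; have tp := prime_image_prime gi p2.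
apply/eqP/negPn/negP => s2.
have t2 : prime_image g 2 != 2.
  by apply: contra_neq s2 => t2; rewrite -{1}t2 (prime_imageK gi).
have t1 : prime_image g 2 = 1 %[mod 2].
  by rewrite modn2; case: (even_prime tp) => [e|->//]; rewrite e in t2.
have := iso_eqmod1_prime hi tp p2 t2 t1; rewrite (prime_imageK gi) //.
by move/(eqmod1 _ (ltn0Sn 1)); rewrite dvdn1 => /eqP e; rewrite e in sp.
Qed.

Lemma in_powers_eqmod1 r q x : prime r -> 1 < q -> q = 1 %[mod wild_mod r] ->
  in_powers r q x <-> x = 1 %[mod r ^ logn r q.-1].
Proof.
move=> rp q1 qr; split=> [/(_ (logn r q.-1))[n <-]|/(powers_dense rp q1 qr)//].
have e : q = 1 %[mod r ^ logn r q.-1].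
  by apply/eqmod1; [exact: ltnW|rewrite pfactor_dvdnn].
by rewrite (eqmodX n e) exp1n.
Qed.

(** The classes of 1 modulo [r ^ k] decrease strictly, so [j] grows strictly with [k], and [j >= k]
    follows by induction from [k0]. *)
Lemma eqmod1_shift (h : nat -> nat) r s k0 : 1 < r ->
  (forall k, k0 <= k -> exists2 j, k0 <= j &
     forall x, x = 1 %[mod r ^ k] <-> h x = 1 %[mod s ^ j]) ->
  forall k x, k0 <= k -> x = 1 %[mod r ^ k] -> h x = 1 %[mod s ^ k].
Proof.
move=> r1 H k x k0k xk.
suff [j kj jP] : exists2 j, k <= j &
    forall x, x = 1 %[mod r ^ k] <-> h x = 1 %[mod s ^ j].
  by apply: eqmod_dvd (dvdn_exp2l s kj) _; exact/jP.
elim: k k0k {x xk} => [|k IH] k0k; first by case: (H 0 k0k) => j _ jP; exists j.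
case: (ltnP k k0) => [kk0|/IH[i ki iP]].
  by have [j j0 jP] := H k.+1 k0k; exists j => //; exact: leq_trans j0.
have [j _ jP] := H k.+1 k0k; exists j => //.
apply: (leq_ltn_trans ki); rewrite ltnNge; apply/negP => ji.
have x1 : 1 + r ^ k = 1 %[mod r ^ k] by rewrite modnDr.
have : 1 + r ^ k = 1 %[mod r ^ k.+1].
  by apply/jP; apply: eqmod_dvd (dvdn_exp2l s ji) _; exact/iP.
move/eqP; rewrite eqn_mod_dvd // addKn gtnNdvd ?expn_gt0 ?(ltnW r1) //.
by rewrite ltn_exp2l.
Qed.

(** For a prime [q] with [q - 1] of valuation [k >= 1], the class of 1 modulo [r ^ k] is the closed
    subgroup of [q]. Its image has the same form because the image of [q] is 1 modulo that of
    [r]. *)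
Lemma iso_eqmod1_odd h g r k x : golomb_iso h g -> prime r -> r != 2 ->
  x = 1 %[mod r ^ k] -> h x = 1 %[mod prime_image h r ^ k].
Proof.
move=> hi rp r2; have [->|k0] := posnP k; first by rewrite !modn1.
apply: (@eqmod1_shift h r (prime_image h r) 1) => // [|{}k {}k0]; first exact: prime_gt1.
have ro : odd r by case: (even_prime rp) r2 => [->|].
have [q qp qk] := ex_prime_logn_pred_odd rp ro k0.
have q0 := prime_gt0 qp; have q1 := prime_gt1 qp.
have sp := prime_image_prime hi rp; have sqp := prime_image_prime hi qp.
have qr1 : q = 1 %[mod r].
  by apply/eqmod1 => //; rewrite -(expn1 r) pfactor_dvdn ?qk //; lia.
have rq : r != q.
  apply: contra_eq_neq qr1 => <-; rewrite modnn modn_small ?prime_gt1 //.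
have sq1 : prime_image h q = 1 %[mod prime_image h r].
  by apply: (iso_eqmod1_prime hi); rewrite // eq_sym.
have s2 : prime_image h r != 2.
  by rewrite -(prime_image_2 hi); exact: (prime_image_neq hi).
have wr p : p != 2 -> wild_mod p = p by rewrite /wild_mod => /negbTE ->.
exists (logn (prime_image h r) (prime_image h q).-1).
  rewrite logn_gt0 mem_primes sp /=; apply/andP; split.
    by have := prime_gt1 sqp; lia.
  by apply/eqmod1 => //; exact: prime_gt0.
move=> y; rewrite -qk.
rewrite -(in_powers_eqmod1 y rp q1) ?wr // -(iso_in_powers y hi) //.
by apply: in_powers_eqmod1; rewrite ?wr ?prime_gt1.
Qed.

Lemma in_powers_trans r a b x : in_powers r a b -> in_powers r b x -> in_powers r a x.
Proof.
move=> ab bx k; have [n nE] := ab k; have [m mE] := bx k.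
by exists (n * m); rewrite expnM (eqmodX m nE).
Qed.

(* If [b] is only an even power of [a] 2-adically then b = 1 mod 8; if it is
   an odd power then [a] and [b] generate the same closed subgroup. *)
Lemma in_powers_two a b : odd a -> odd b -> in_powers 2 a b -> ~ in_powers 2 b a ->
  b = 1 %[mod 8].
Proof.
move=> oa ob ab nba; apply: contrapT => b8; apply: nba => k.
have [n nE] := ab (maxn k 3).
have nE8 : a ^ n = b %[mod 8] by apply: (eqmod_dvd _ nE); rewrite (@dvdn_exp2l 2 3) ?leq_maxr.
have on : odd n.
  apply: contra_notT b8 => en; rewrite -nE8.
  have -> : n = n./2 * 2 by rewrite muln2 -{1}[n]odd_double_half (negbTE en).
  rewrite mulnC expnM; have -> : a ^ 2 = 1 %[mod 8] -> (a ^ 2) ^ n./2 = 1 %[mod 8].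
    by move=> e; rewrite (eqmodX _ e) exp1n.
  - by [].
  - rewrite -modnXm; have : a %% 8 < 8 by rewrite ltn_mod.
    have : odd (a %% 8) by rewrite odd_mod.
    by case: (a %% 8) => [|[|[|[|[|[|[|[|]]]]]]]].
have a2k : a ^ 2 ^ k = 1 %[mod 2 ^ k].
  by apply: (@eqmod_dvd _ (2 ^ k.+1)); [exact: dvdn_exp2l|apply: expn_r_eq1; rewrite !modn2 oa].
have [j jE] : exists j, n * j = 1 %[mod 2 ^ k].
  by apply: eqmod_solve; rewrite ?expn_gt0 // coprimeXr // coprimen2.
exists j; rewrite -(expn1 a) -(eqmod_expn a2k jE) expnM; symmetry; apply: eqmodX.
by apply: (eqmod_dvd _ nE); rewrite dvdn_exp2l // leq_maxl.
Qed.

(** Being 1 modulo 2 is too weak to describe the subgroup of [sq]. The strictly larger subgroup of a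
    prime [q2] with [q2 - 1] of valuation 2 forces [sq = 1] modulo 8 through [in_powers_two]. *)
Lemma iso_eqmod1_two h g k x : golomb_iso h g -> 2 < k ->
  x = 1 %[mod 2 ^ k] -> h x = 1 %[mod 2 ^ k].
Proof.
move=> hi; apply: eqmod1_shift => // {}k k3.
have [hg gh _ _ _] := hi; have gi := golomb_iso_sym hi; have p2 : prime 2 by [].
have s2 := prime_image_2 hi.
have [q qp qk] := ex_prime_logn_pred_two (ltnW k3).
have [q2 q2p q2k] := @ex_prime_logn_pred_two 2 isT.
have mod4 p : prime p -> 1 < logn 2 p.-1 -> p = 1 %[mod 4].
  by move=> pp pk; apply/eqmod1; [exact: prime_gt0|rewrite (@pfactor_dvdn 2 2) //; have := prime_gt1 pp; lia].
have q4 : q = 1 %[mod 4] by apply: mod4; rewrite // qk ltnW.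
have q24 : q2 = 1 %[mod 4] by apply: mod4; rewrite // q2k.
have odd4 p : p = 1 %[mod 4] -> 2 != p by apply: contra_eq_neq => <-.
have Uk y := in_powers_eqmod1 y p2 (prime_gt1 qp) q4; rewrite qk in Uk.
have U2 y := in_powers_eqmod1 y p2 (prime_gt1 q2p) q24; rewrite q2k in U2.
have isoq y := iso_in_powers y hi p2 qp (odd4 _ q4); rewrite s2 in isoq.
have isoq2 y := iso_in_powers y hi p2 q2p (odd4 _ q24); rewrite s2 in isoq2.
set sq := prime_image h q in isoq; set sq2 := prime_image h q2 in isoq2.
have oddp p : prime p -> 2 != p -> odd p.
  by move=> pp; case: (even_prime pp) => [->|].
have sqp : prime sq := prime_image_prime hi qp.
have sqo : odd sq.
  by apply: oddp => //; rewrite -{1}s2; exact: (prime_image_neq hi p2 qp (odd4 _ q4)).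
have sq2o : odd sq2.
  apply: oddp; first exact: prime_image_prime hi q2p.
  by rewrite -{1}s2; exact: (prime_image_neq hi p2 q2p (odd4 _ q24)).
have sq8 : sq = 1 %[mod 8].
  apply: (in_powers_two sq2o sqo).
    rewrite -(gh sq) isoq2 U2; apply: (@eqmod_dvd _ (2 ^ k)).
      by rewrite dvdn_exp2l // ltnW.
    by apply/Uk/isoq; rewrite gh => i; exists 1; rewrite expn1.
  (* The number 5 is 1 modulo 4 but not modulo 8, so it separates the two subgroups. *)
  move=> sqsq2; have : in_powers 2 sq (h 5).
    by apply: in_powers_trans sqsq2 _; apply/isoq2/U2.
  by move/isoq/Uk/(eqmod_dvd (dvdn_exp2l 2 k3)).
exists (logn 2 sq.-1).
  rewrite -(@pfactor_dvdn 2 3) //; first by apply/eqmod1; [exact: prime_gt0|].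
  by have := prime_gt1 sqp; lia.
move=> y; rewrite -Uk -isoq; apply: in_powers_eqmod1 => //; first exact: prime_gt1.
exact: (@eqmod_dvd _ 8).
Qed.

Lemma iso_pred_dvd h g r k n : golomb_iso h g -> prime r -> r != 2 ->
  0 < n -> (prime_image h r ^ k %| (h n).-1) = (r ^ k %| n.-1).
Proof.
move=> hi rp r2 n0; have [hg _ _ _ _] := hi; have gi := golomb_iso_sym hi.
have hn0 := iso_gt0 hi n0; have s2 : prime_image h r != 2.
  by rewrite -(prime_image_2 hi); exact: (prime_image_neq hi).
apply/idP/idP => /eqmod1 e; apply/eqmod1 => //.
  have := iso_eqmod1_odd gi (prime_image_prime hi rp) s2 (e hn0).
  by rewrite hg (prime_imageK hi rp).
exact: iso_eqmod1_odd hi rp r2 (e n0).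
Qed.

Lemma eq_logn_dvd p q m n : prime p -> prime q -> 0 < m -> 0 < n ->
  (forall k, (p ^ k %| m) = (q ^ k %| n)) -> logn p m = logn q n.
Proof.
move=> pp qp m0 n0 H; apply/eqP; rewrite eqn_leq -!pfactor_dvdn //.
by apply/andP; split; [rewrite -H|rewrite H]; rewrite pfactor_dvdnn.
Qed.

Lemma iso_pred_gt0 h g n : golomb_iso h g -> 1 < n -> 0 < (h n).-1.
Proof.
move=> hi n1; have hn0 := iso_gt0 hi (ltnW n1).
have : h n != 1.
  apply/negP => /eqP e; have n_1 : n = 1 by apply: (iso_inj hi); rewrite (iso_1 hi).
  by rewrite n_1 in n1.
by case: (h n) hn0 => [|[]].
Qed.

Lemma iso_logn_pred h g r n : golomb_iso h g -> prime r -> r != 2 -> 1 < n ->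
  logn (prime_image h r) (h n).-1 = logn r n.-1.
Proof.
move=> hi rp r2 n1; apply: eq_logn_dvd => //; first exact: prime_image_prime hi rp.
- exact: (iso_pred_gt0 hi).
- by rewrite -ltnS prednK // ltnW.
- by move=> k; apply: (iso_pred_dvd k hi); rewrite // ltnW.
Qed.

(** The case [k = 1] is parity; [k = 2] stays open because [iso_eqmod1_two] starts at 3. *)
Lemma iso_pred_dvd2 h g k n : golomb_iso h g -> 0 < n ->
  (2 < k) || (k == 1) -> (2 ^ k %| (h n).-1) = (2 ^ k %| n.-1).
Proof.
move=> hi n0; have hn0 := iso_gt0 hi n0; have gi := golomb_iso_sym hi.
have [hg _ _ _ _] := hi.
case/orP=> [k2|/eqP ->].
  apply/idP/idP => /eqmod1 e; apply/eqmod1 => //.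
    by rewrite -(hg n); exact: iso_eqmod1_two gi k2 (e hn0).
  exact: iso_eqmod1_two hi k2 (e n0).
have := prime_image_dvd n hi (isT : prime 2); rewrite (prime_image_2 hi) !dvdn2.
by case: n n0 hn0 => // n _; case: (h _) => //= m _ /negb_inj.
Qed.

Lemma iso_logn_pred_2 h g n : golomb_iso h g -> 1 < n ->
  let a := logn 2 (h n).-1 in let b := logn 2 n.-1 in
  a = b \/ (a = 1 /\ b = 2) \/ (a = 2 /\ b = 1).
Proof.
move=> hi n1 a b.
have y0 : 0 < (h n).-1 := iso_pred_gt0 hi n1.
have x0 : 0 < n.-1 by rewrite -ltnS prednK // ltnW.
have E k : (2 < k) || (k == 1) -> (k <= a) = (k <= b).
  by rewrite -!pfactor_dvdn //; apply: iso_pred_dvd2 hi (ltnW n1).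
have := E 1 isT; have := E 3 isT; have := E a; have := E b; rewrite !leqnn.
lia.
Qed.

(** * Rigidity by induction *)

Lemma prime_image_fixed h p : prime p -> h p = p -> prime_image h p = p.
Proof. by move=> pp hp; rewrite /prime_image hp pdiv_id. Qed.

(** Primes up to [n] are their own images. A prime [p > n] comes from a prime [r > n], and neither
    divides [n]. *)
Lemma iso_pred_odd_part h g n p : golomb_iso h g -> (forall x, x <= n -> h x = x) ->
  0 < n -> prime p -> p != 2 -> logn p (h n.+1).-1 = logn p n.
Proof.
move=> hi IH n0 pp p2; have gi := golomb_iso_sym hi.
pose r := prime_image g p; have rp : prime r := prime_image_prime gi pp.
have rK : prime_image h r = p := prime_imageK gi pp.
have r2 : r != 2 by rewrite -(prime_image_2 gi); exact: (prime_image_neq gi).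
have := iso_logn_pred hi rp r2 (n0 : 1 < n.+1); rewrite rK /= => ->.
have small x : prime x -> x <= n -> prime_image h x = x.
  by move=> xp xn; apply: prime_image_fixed; rewrite ?IH.
case: (leqP p n) => pn; first by rewrite -[in RHS](prime_imageK hi pp) small.
case: (leqP r n) => rn; first by move: pn; rewrite -rK small // ltnNge rn.
have zero x : n < x -> logn x n = 0.
  by move=> nx; apply/eqP; rewrite -leqn0 leqNgt logn_gt0 mem_primes n0 gtnNdvd ?andbF.
by rewrite !zero.
Qed.

Theorem iso_id h g : golomb_iso h g -> h =1 id.
Proof.
move=> hi x; have [hg gh h0 _ _] := hi; have gi := golomb_iso_sym hi.
suff H n : forall x, x <= n -> h x = x by exact: (H x).
elim: n {x} => [x|n IH x]; first by rewrite leqn0 => /eqP ->.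
rewrite leq_eqVlt ltnS => /orP[/eqP ->|]; last exact: IH.
case: (posnP n) => [->|n0]; first exact: (iso_1 hi).
have odd_part p := iso_pred_odd_part hi IH n0 (p := p).
set y := (h n.+1).-1 in odd_part.
have y0 : 0 < y by apply: (iso_pred_gt0 hi).
have hE : h n.+1 = y.+1 by rewrite prednK // (iso_gt0 hi).
pose a := logn 2 y; pose b := logn 2 n.
have nyE : n * 2 ^ a = y * 2 ^ b.
  apply: eqn_from_log; rewrite ?muln_gt0 ?n0 ?y0 ?expn_gt0 // => p.
  rewrite !lognM ?expn_gt0 // !lognX.
  have [->|p2] := eqVneq p 2; first by rewrite -/a -/b !muln1 addnC.
  case: (boolP (prime p)) => pp; first by rewrite !(logn_prime p (q := 2)) // (negbTE p2) !muln0 odd_part.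
  by rewrite /logn (negbTE pp) !muln0.
have [ab|[[a1 b2]|[a2 b1]]] := iso_logn_pred_2 hi (n0 : 1 < n.+1).
- rewrite hE; congr _.+1; move/eqP: nyE; rewrite /a ab /b eqn_pmul2r ?expn_gt0 //.
  by move/eqP.
(* Here [y.+1 <= n] is already fixed, yet it is also the value at [n.+1]. *)
- have n2 : n = 2 * y by move: nyE; rewrite /a /b a1 b2; lia.
  have : h n.+1 = h y.+1 by rewrite hE IH //; lia.
  by move/(iso_inj hi); lia.
(* The remaining case is [h n.+1 = 2 n + 1]; the value at [n.+2] will exclude it. *)
exfalso.
have y2 : y = 2 * n by move: nyE; rewrite /a /b a2 b1; lia.
have ne : ~~ odd n.
  rewrite -dvdn2 -{1}(expn1 2) pfactor_dvdn //; move: b1; rewrite /= => ->.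
  by [].
have small p : prime p -> p <= n -> prime_image h p = p.
  by move=> pp pn; apply: prime_image_fixed; rewrite ?IH.
(* A prime factor of [n.+1] up to [n] is its own image, so it would divide [2 n + 1] and hence
   [n]. *)
have n1p : prime n.+1.
  apply/negPn/negP => n1p; have n1 : 1 < n.+1 by [].
  have pp := pdiv_prime n1; have pd := pdiv_dvd n.+1.
  have pn : pdiv n.+1 <= n.
    rewrite -ltnS ltn_neqAle dvdn_leq // andbT; apply: contraNneq n1p => e.
    by rewrite -e.
  have := prime_image_dvd n.+1 hi pp; rewrite pd small // hE y2.
  have -> : (2 * n).+1 = n + n.+1 by lia.
  rewrite dvdn_addl // => pn'.
  by move: pd; rewrite -add1n dvdn_addl // dvdn1 => /eqP e; rewrite e in pp.
pose t := prime_image h n.+1; have tp : prime t := prime_image_prime hi n1p.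
have n1_2 : n.+1 != 2 by apply: contraNneq ne => - [->].
have t2 : t != 2 by rewrite -(prime_image_2 hi); exact: (prime_image_neq hi).
have to : odd t by case: (even_prime tp) t2 => [->|].
have [c tc] := prime_image_pow 1 hi n1p; rewrite expn1 hE y2 -/t in tc.
have z0 : 0 < (h n.+2).-1 by exact: (iso_pred_gt0 hi).
(* Valuations are transported from the odd prime [n.+1], whose image is [t]. *)
have zt : (h n.+2).-1 = t.
  apply: eqn_from_log => // [|p]; first exact: prime_gt0.
  case: (boolP (prime p)) => pp; last by rewrite /logn (negbTE pp).
  have [->|p2] := eqVneq p 2.
    have l0 m : odd m -> logn 2 m = 0.
      by move=> om; apply/eqP; rewrite -leqn0 leqNgt logn_gt0 mem_primes dvdn2 om andbF.
    rewrite (l0 t) // l0 //.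
    have := iso_pred_dvd2 hi (ltn0Sn n.+1) (isT : (2 < 1) || (1 == 1)).
    by rewrite expn1 !dvdn2 /= ne => /negbFE.
  have rp := prime_image_prime gi pp; have rK := prime_imageK gi pp.
  have r2 : prime_image g p != 2 by rewrite -(prime_image_2 gi); exact: (prime_image_neq gi).
  have := iso_logn_pred hi rp r2 (isT : 1 < n.+2); rewrite rK /= => ->.
  rewrite !logn_prime //; congr nat_of_bool; apply/eqP/eqP => [e|->].
    by rewrite /t -e rK.
  exact: prime_imageK hi n1p.
have hE2 : h n.+2 = t.+1 by rewrite -zt prednK // (iso_gt0 hi).
have n2 : 1 < n by case: (n) n0 ne => [|[]].
have t3 : 2 < t by case: (t) tp t2 => [|[|[|]]].
(* If [t = 2 n + 1], then [h n.+2 = 2 (n + 1)], so the prime with image [n.+1] divides [n.+2]. It is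
   not below [n.+1], where images are known, nor equal to [n.+1], nor to the even number [n.+2]. *)
case: c tc => [|[|c]] tc; first by move: tc; rewrite expn0; lia.
  have pr := prime_image_prime gi n1p; have rK := prime_imageK gi n1p.
  have := prime_image_dvd n.+2 hi pr; rewrite rK hE2 -(expn1 t) -tc.
  have -> : (2 * n).+2 = 2 * n.+1 by lia.
  rewrite dvdn_mull // => /esym rd.
  have rle := dvdn_leq (ltn0Sn n.+1) rd.
  case: (ltngtP (prime_image g n.+1) n.+1) => rn.
  - by have := small _ pr rn; rewrite rK => e; rewrite -e ltnn in rn.
  - have re : prime_image g n.+1 = n.+2 by lia.
    rewrite re in pr; case: (even_prime pr) => [|]; first lia.
    by rewrite /= negbK (negbTE ne).
  - by move: rd; rewrite rn -[X in _ %| X]addn1 dvdn_addr // dvdn1; lia.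
(* For an exponent at least 2, [t.+1 <= n] is already fixed, yet it equals [h n.+2]. *)
have tt : t ^ 2 <= (2 * n).+1 by rewrite tc leq_exp2l // prime_gt1.
have tn : t.+1 <= n by nia.
have := IH _ tn; rewrite -hE2 => /(iso_inj hi); lia.
Qed.

(** * The Golomb space *)

Local Open Scope classical_set_scope.

Definition nat_ext (h : posnat -> posnat) (n : nat) : nat :=
  if insub n is Some x then h x : nat else 0.

Lemma nat_ext_val h (x : posnat) : nat_ext h x = h x.
Proof. by rewrite /nat_ext (valK x). Qed.

Lemma nat_ext0 h : nat_ext h 0 = 0.
Proof. by rewrite /nat_ext insubF. Qed.

Lemma nat_extK h g : cancel h g -> cancel (nat_ext h) (nat_ext g).
Proof.
move=> hg n; case: (posnP n) => [->|n0]; first by rewrite !nat_ext0.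
by rewrite -[n]/(nat_of_posnat (Posnat n0)) !nat_ext_val hg.
Qed.

Lemma open_residue (a b : nat) : 0 < b -> coprime a b ->
  open [set y : posnat | nat_of_posnat y = a %[mod b]].
Proof.
move=> b0 ab; apply/golomb_openP => y /= ya; exists y, (Posnat b0); split=> /=.
- by rewrite (eqmod_coprime ya).
- by exists 0; rewrite muln0 addn0.
- by move=> z [n /= ->]; rewrite addnC mulnC modnMDl.
Qed.

Lemma nat_ext_continuous h : continuous h -> golomb_continuous (nat_ext h).
Proof.
move=> hc x b b0; case: (posnP x) => [->|x0].
  rewrite nat_ext0 /coprime gcd0n => /eqP ->.
  by exists 1; split; rewrite // => y; rewrite !modn1.
rewrite -[x]/(nat_of_posnat (Posnat x0)); move: (Posnat x0) => {x0}x.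
rewrite nat_ext_val => hxb.
have /continuousP/(_ _ (open_residue b0 hxb))/golomb_openP/(_ x erefl) := hc.
case=> a [c [ac [n xE] sub]].
have xc : coprime x c.
  by rewrite xE coprime_sym /coprime mulnC addnC gcdnMDl -/(coprime _ _) coprime_sym.
(* The factor [x.+1], coprime to [x], pushes the modulus above [x], so every [y] in the class is at
   least [x] and stays in the progression. *)
exists (c * x.+1); split; first by rewrite muln_gt0 posnat_gt0.
  by rewrite coprimeMr xc coprimenS.
move=> y yx; have xlt : x < c * x.+1 by rewrite leq_pmull // posnat_gt0.
rewrite (modn_small xlt) in yx.
have y0 : 0 < y by apply: leq_trans (leq_mod y (c * x.+1)); rewrite yx posnat_gt0.
rewrite -[y]/(nat_of_posnat (Posnat y0)) nat_ext_val; apply: sub.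
exists (n + y %/ (c * x.+1) * x.+1).
by rewrite /= {1}(divn_eq y (c * x.+1)) yx xE; lia.
Qed.

Lemma homeomorphism_iso (h : posnat -> posnat) : homeomorphism h ->
  exists g, golomb_iso (nat_ext h) (nat_ext g).
Proof.
case=> g [hg gh hc gc]; exists g; split.
- exact: nat_extK.
- exact: nat_extK.
- exact: nat_ext0.
- exact: nat_ext_continuous.
- exact: nat_ext_continuous.
Qed.

Lemma golomb_rigid (h : posnat -> posnat) : homeomorphism h -> h =1 id.
Proof.
move=> /homeomorphism_iso[g hi] x; apply: val_inj.
by rewrite /= -nat_ext_val (iso_id hi).
Qed.

Theorem theorem5p1 (h : posnat -> posnat) (hh : homeomorphism h) :
  [/\ h 1%g = 1%g,
      h @` primes_set = primes_set,
      forall x : posnat, prime_divisors (h x) = h @` prime_divisors x &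
      exists mu : posnat -> posnat,
        [/\ bijective mu,
            forall x y : posnat, mu (x * y)%g = (mu x * mu y)%g &
            forall x n : posnat, h (x ^+ n)%g = (h x ^+ mu n)%g]].
Proof.
have -> : h = id by apply: funext; exact: golomb_rigid.
split=> [|||]; rewrite ?image_id //; first by move=> x; rewrite image_id.
by exists id; split=> //; exists id.
Qed.
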